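(* Let $\mathcal H$ be any spanning family of graphs and let $K=A_{\mathcal H}^{T}B_{\mathcal H_{\mathrm{rev}}}^{-1}$ (an infinite matrix which does not depend on the choice of $\mathcal H$). For any graph $G$ and its reverse $G_{\mathrm{rev}}$, the Tutte symmetric matrices satisfy $$K\,M_{G_{\mathrm{rev}}}=M_G^{T}\,K .$$
   Context: $[n]=\{1,\dots,n\}$, $t$ is an indeterminate. A graph is $G=([n],E)$ with $n\ge 1$ and $E$ a set of 2-element subsets of $[n]$; the definitions below apply verbatim to loopless multigraphs (parallel edges regarded as distinct), and members of a spanning family may have parallel edges. $P_j$ is the path on $[j]$ with edges $\{i,i+1\}$. For $G=([n],E)$ and $H=([n'],E')$, the sum $G+H=([n+n'-1],E\cup\{\{i+n-1,j+n-1\}:\{i,j\}\in E'\})$ glues vertex $n$ of $G$ to vertex $1$ of $H$. The reverse of $G$ is $G_{\mathrm{rev}}=([n],\{\{i,j\}:\{n+1-j,n+1-i\}\in E\})$. $e_n=\sum_{i_1<\cdots<i_n}x_{i_1}\cdots x_{i_n}$, $e_0=1$, and $e_\lambda=e_{\lambda_1}\cdots e_{\lambda_\ell}$ for a partition $\lambda$. A composition is a finite sequence $\alpha=(\alpha_1,\dots,\alpha_\ell)$ of positive integers; $\ell=\ell(\alpha)$ is its length, $\alpha_\ell$ its last part, its size is the sum of its parts; $\mathrm{sort}(\alpha)$ is the partition obtained by sorting. A component triple of $G$ is $\mathcal C=(C,\alpha,r)$ where $C$ is a connected (not necessarily induced) subgraph of $G$, $\alpha$ is a composition of size $|C|$ (number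 of vertices), and $1\le r\le\alpha_1$ is an integer. A subgraph triple $\mathcal S$ of $G$ is a collection of component triples $(C_1,\alpha^{(1)},r_1),\dots,(C_m,\alpha^{(m)},r_m)$ such that the disjoint union $C_1\sqcup\cdots\sqcup C_m$ is a spanning subgraph of $G$; the order of listing is immaterial. $\mathrm{ST}(G)$ is the set of subgraph triples. $\mathrm{type}(\mathcal S)=\mathrm{sort}(\alpha^{(1)}\cdots\alpha^{(m)})$ (concatenate and sort); $\mathrm{sign}(\mathcal S)=(-1)^{N-\ell(\mathrm{type}(\mathcal S))}$ with $N$ the number of vertices of the graph; $E(\mathcal S)$ is the total number of edges in $C_1,\dots,C_m$; the reduced type $\mathrm{type}'(\mathcal S)$ is $\mathrm{type}(\mathcal S)$ with one instance of $\alpha_1$ removed, where $\alpha$ is the composition of the component containing vertex $1$. For $G=([n],E)$ and $i,j\ge1$, $\mathrm{ST}^{(i)}(G+P_j)$ is the set of $\mathcal S\in\mathrm{ST}(G+P_j)$ such that, with $(C,\alpha,r)$ the component triple with $1\in C$ and $(C',\alpha',r')$ the component triple with $n\in C'$ (possibly the same), one has $\alpha_1=i$, $r=1$, $\{n,n+1,\dots,n+j-1\}\subseteq C'$, and the last part satisfies $\alpha'_\ell\ge j$. The Tutte symmetric matrix $M_G$ is the infinite matrix with entries $$(M_G)_{i,j}=\sum_{\mathcal S\in\mathrm{ST}^{(i)}(G+P_j)}\mathrm{sign}(\mathcal S)\,(-1)^{1-j}\,t^{E(\mathcal S)+1-j}\,e_{\mathrm{type}'(\mathcal S)},\qquad i,j\ge1;$$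 each of its columns has finitely many nonzero entries. A spanning family of graphs is a sequence $\mathcal H=H_1,H_2,\dots$ of connected, loopless graphs with $|H_i|=i$ vertices; $\mathcal H_{\mathrm{rev}}=(H_1)_{\mathrm{rev}},(H_2)_{\mathrm{rev}},\dots$. With $\vec v=[\,e_1\ 2e_2\ 3e_3\cdots]$, define infinite matrices $(A_{\mathcal H})_{i,j}=(\vec vM_{H_i})_j$ and $(B_{\mathcal H})_{i,j}=(M_{H_j})_{i,1}$. Matrices have entries in the ring of symmetric functions with coefficients in $\mathbb Q(t)$. Every $B_{\mathcal H}$ is upper triangular with an upper triangular two-sided inverse $B_{\mathcal H}^{-1}$, so all the products above are given by finite sums. *)

(* Defs.v *)
From HB Require Import structures.
From mathcomp Require Import all_boot all_order all_fingroup all_algebra.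
From mathcomp Require Import boolp classical_sets functions cardinality fsbigop.
From mathcomp Require Import mpoly.

Set Implicit Arguments.
Unset Strict Implicit.
Unset Printing Implicit Defensive.

Import GRing.Theory.
Local Open Scope ring_scope.

(* A symmetric function in x_1, x_2, ... is given by its truncations
   f(x_1, ..., x_N, 0, 0, ...), one polynomial in N variables for each N:
   they are symmetric, compatible with setting the last variable to 0, and
   of bounded degree.  Operations are computed truncation by truncation. *)

Section SymFun.
Variable F : fieldType.

Definition truncations : Type := forall N : nat, {mpoly F[N]}.

HB.instance Definition _ := gen_eqMixin truncations.
HB.instance Definition _ := gen_choiceMixin truncations.

Implicit Types f g h : truncations.

Definition trunc_add f g : truncations := fun N => f N + g N.
Definition trunc_opp f : truncations := fun N => - f N.
Definition trunc_mul f g : truncations := fun N => f N * g N.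
Definition trunc_scale (c : F) f : truncations := fun N => c *: f N.

Lemma truncP f g : (forall N, f N = g N) -> f = g.
Proof. exact: functional_extensionality_dep. Qed.

Fact trunc_addA : associative trunc_add.
Proof. by move=> f g h; apply: truncP => N; rewrite /trunc_add addrA. Qed.
Fact trunc_addC : commutative trunc_add.
Proof. by move=> f g; apply: truncP => N; rewrite /trunc_add addrC. Qed.
Fact trunc_add0 : left_id ((fun=> 0) : truncations) trunc_add.
Proof. by move=> f; apply: truncP => N; rewrite /trunc_add add0r. Qed.
Fact trunc_addN : left_inverse ((fun=> 0) : truncations) trunc_opp trunc_add.
Proof. by move=> f; apply: truncP => N; rewrite /trunc_add addNr. Qed.

HB.instance Definition _ := GRing.isZmodule.Build truncations
  trunc_addA trunc_addC trunc_add0 trunc_addN.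

Fact trunc_mulA : associative trunc_mul.
Proof. by move=> f g h; apply: truncP => N; rewrite /trunc_mul mulrA. Qed.
Fact trunc_mulC : commutative trunc_mul.
Proof. by move=> f g; apply: truncP => N; rewrite /trunc_mul mulrC. Qed.
Fact trunc_mul1 : left_id ((fun=> 1) : truncations) trunc_mul.
Proof. by move=> f; apply: truncP => N; rewrite /trunc_mul mul1r. Qed.
Fact trunc_mulDl : left_distributive trunc_mul +%R.
Proof. by move=> f g h; apply: truncP => N; exact: mulrDl. Qed.
Fact trunc_1neq0 : ((fun=> 1) : truncations) != 0.
Proof.
apply/eqP => /(congr1 (fun f : truncations => f 0%N)) /eqP.
by rewrite oner_eq0.
Qed.

HB.instance Definition _ := GRing.Zmodule_isComNzRing.Build truncations
  trunc_mulA trunc_mulC trunc_mul1 trunc_mulDl trunc_1neq0.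

Fact trunc_scaleA (a b : F) f :
  trunc_scale a (trunc_scale b f) = trunc_scale (a * b) f.
Proof. by apply: truncP => N; rewrite /trunc_scale scalerA. Qed.
Fact trunc_scale1 : left_id 1 trunc_scale.
Proof. by move=> f; apply: truncP => N; rewrite /trunc_scale scale1r. Qed.
Fact trunc_scaleDr : right_distributive trunc_scale +%R.
Proof. by move=> a f g; apply: truncP => N; exact: scalerDr. Qed.
Fact trunc_scaleDl f : {morph trunc_scale^~ f : a b / a + b}.
Proof. by move=> a b; apply: truncP => N; exact: scalerDl. Qed.

HB.instance Definition _ := GRing.Zmodule_isLmodule.Build F truncations
  trunc_scaleA trunc_scale1 trunc_scaleDr trunc_scaleDl.

Fact trunc_scaleAl (a : F) f g : a *: (f * g) = (a *: f) * g.
Proof. by apply: truncP => N; exact: scalerAl. Qed.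

HB.instance Definition _ := GRing.Lmodule_isLalgebra.Build F truncations
  trunc_scaleAl.

Fact trunc_scaleAr (a : F) f g : a *: (f * g) = f * (a *: g).
Proof. by apply: truncP => N; exact: scalerAr. Qed.

HB.instance Definition _ := GRing.Lalgebra_isAlgebra.Build F truncations
  trunc_scaleAr.

Definition last_to_0 N : N.+1.-tuple {mpoly F[N]} :=
  [tuple (if unlift ord_max i is Some j then 'X_j else 0) | i < N.+1].

Definition truncation_of_symfun f : Prop :=
  [/\ forall N, f N \is symmetric,
      forall N, f N.+1 \mPo last_to_0 N = f N
    & exists d, forall N, (msize (f N) <= d)%N].

Definition symfun_pred : {pred truncations} :=
  fun f => `[< truncation_of_symfun f >].

Fact symfun_subalg_closed : subalg_closed symfun_pred.
Proof.
split=> [|c f g|f g].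
- apply/asboolP; split=> [N|N|]; first exact: rpred1.
    exact: comp_mpoly1.
  by exists 1%N => N; rewrite msize1.
- move=> /asboolP[fS fC [d fd]] /asboolP[gS gC [e ge]].
  have cfgE N : (c *: f + g) N = c *: f N + g N by [].
  apply/asboolP; split=> [N|N|]; first by rewrite cfgE rpredD ?gS ?rpredZ ?fS.
    by rewrite !cfgE comp_mpolyD comp_mpolyZ fC gC.
  exists (maxn d e) => N; rewrite cfgE; apply: leq_trans (msizeD_le _ _) _.
  by rewrite geq_max !leq_max (leq_trans (msizeZ_le _ _) (fd N)) ge orbT.
- move=> /asboolP[fS fC [d fd]] /asboolP[gS gC [e ge]].
  have fgE N : (f * g) N = f N * g N by [].
  apply/asboolP; split=> [N|N|]; first by rewrite fgE rpredM ?fS ?gS.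
    by rewrite !fgE rmorphM /= fC gC.
  exists (d + e).+1%N => N; rewrite fgE; apply: leq_trans (msizeM_le _ _) _.
  by rewrite ltnS leq_add.
Qed.

HB.instance Definition _ :=
  GRing.isSubalgClosed.Build F truncations symfun_pred symfun_subalg_closed.

Record symfun := SymFun {
  symfun_trunc :> truncations;
  symfun_truncP : symfun_trunc \in symfun_pred
}.

HB.instance Definition _ := [isSub for symfun_trunc].
HB.instance Definition _ := [Choice of symfun by <:].
HB.instance Definition _ := [SubChoice_isSubComNzRing of symfun by <:].
HB.instance Definition _ := [SubZmodule_isSubLmodule of symfun by <:].
HB.instance Definition _ :=
  [SubNzRing_SubLmodule_isSubLalgebra of symfun by <:].
HB.instance Definition _ := [SubLalgebra_isSubAlgebra of symfun by <:].

Lemma mwiden_last_to_0 N (p : {mpoly F[N]}) : mwiden p \mPo last_to_0 N = p.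
Proof.
rewrite [RHS]mpolyE [X in mwiden X]mpolyE.
rewrite (big_morph _ (@mwidenD N F) (mwiden0 N F)) raddf_sum /=; apply: eq_bigr => m _.
rewrite mwidenZ mwidenX comp_mpolyZ comp_mpolyX; congr (_ *: _).
rewrite big_ord_recr /= mnmwiden_ordmax expr0 mulr1 [RHS]mpolyXE_id.
apply: eq_bigr => i _; rewrite tnth_mktuple.
have -> : widen_ord (leqnSn N) i = lift ord_max i.
  by apply: val_inj; rewrite /= /bump leqNgt ltn_ord.
rewrite liftK; congr (_ ^+ _).
rewrite -[RHS](mnmwiden_widen m i); congr (mnmwiden m _).
by apply: val_inj; rewrite /= /bump leqNgt ltn_ord.
Qed.

Fact esym_subproof k :
  ((fun N => mesym N F k) : truncations) \in symfun_pred.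
Proof.
apply/asboolP; split=> [N|N|]; first exact: mesym_sym.
  case: k => [|k]; first by rewrite !mesym0E comp_mpoly1.
  rewrite mesymSS comp_mpolyD rmorphM /= !mwiden_last_to_0.
  by rewrite comp_mpolyXU -tnth_nth tnth_mktuple unlift_none mulr0 addr0.
exists k.+1 => N; have /dhomogP hom := dhomog_mesym N F k.
rewrite msizeE; apply/bigmax_leqP_seq => m mk _.
by rewrite ltnS; have := hom m mk => /= ->.
Qed.

(* [mesym N F k] is the sum of all products of k distinct variables among
   x_1, ..., x_N. *)
Definition esym k : symfun := SymFun (esym_subproof k).

Definition esym_seq (la : seq nat) : symfun := \prod_(k <- la) esym k.

End SymFun.

Notation Qt := {fraction {poly rat}}.
Definition tvar : Qt := tofrac 'X.
Notation Lambda := (symfun Qt).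

(* Rows and columns are numbered from 0, so that the entry [A i j] is the
   entry of index (i+1, j+1) when they are numbered from 1.  The sum
   [\sum_(k \in [set: nat]) _] is that of the nonzero terms when these are
   in finite number (and 0 otherwise). *)

Section InfiniteMatrix.
Variable R : nzRingType.

Definition imatrix := nat -> nat -> R.

Implicit Types (A B : imatrix) (u : nat -> R).

Definition imul A B : imatrix :=
  fun i j => \sum_(k \in [set: nat]%classic) A i k * B k j.

Definition ivecmul u A : nat -> R :=
  fun j => \sum_(k \in [set: nat]%classic) u k * A k j.

Definition itr A : imatrix := fun i j => A j i.

Definition i1 : imatrix := fun i j => (i == j)%:R.

Definition iupper A : Prop := forall i j, (j < i)%N -> A i j = 0.

(* The upper triangular two-sided inverse, which is unique if it exists. *)
Definition iinv A : imatrix :=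
  xget (fun _ _ => 0)
    [set B : imatrix | [/\ iupper B, imul A B = i1 & imul B A = i1]]%classic.

End InfiniteMatrix.

(* Loopless multigraphs on n vertices; [i : 'I_n] stands for vertex i+1. *)
Record mgraph (n : nat) := MGraph {
  edge : finType;
  ends : edge -> {set 'I_n};
  card_ends : forall e, #|ends e| == 2
}.

(* The ends of the edges in [D] are meant to lie in [V]; the empty graph is
   not connected. *)
Definition subgraph_connected n (G : mgraph n)
    (V : {set 'I_n}) (D : {set edge G}) : bool :=
  (V != finset.set0) &&
  [forall u in V, forall v in V,
     connect (fun x y => [exists e in D, ends e == [set x; y]%SET]) u v].

Definition connected_graph n (G : mgraph n) : bool :=
  @subgraph_connected n G [set: 'I_n]%SET [set: edge G]%SET.

Section GraphConstructions.

Fact gpath_subproof j (e : 'I_j) :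
  #|[set widen_ord (leqnSn j) e; lift ord0 e]%SET| == 2.
Proof. by rewrite cards2 -val_eqE /= /bump leq0n add1n eqSS neq_ltn ltnSn. Qed.

(* The path with j+1 vertices. *)
Definition gpath j : mgraph j.+1 := MGraph (@gpath_subproof j).

Definition grev_ends n (G : mgraph n) (e : edge G) : {set 'I_n} :=
  [set rev_ord v | v in ends e]%SET.

Fact grev_subproof n (G : mgraph n) e : #|@grev_ends n G e| == 2.
Proof. by rewrite card_imset ?card_ends //; exact: rev_ord_inj. Qed.

Definition grev n (G : mgraph n) : mgraph n := MGraph (@grev_subproof n G).

(* The two embeddings of vertices for the sum of graphs with n+1 and m+1
   vertices, which has n+m+1 vertices: i |-> i and i |-> i + n. *)
Definition gadd_lvertex n m (i : 'I_n.+1) : 'I_(n + m).+1 := lshift m i.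
Definition gadd_rvertex n m (i : 'I_m.+1) : 'I_(n + m).+1 :=
  cast_ord (addnS n m) (rshift n i).

Definition gadd_ends n m (G : mgraph n.+1) (H : mgraph m.+1)
    (e : edge G + edge H) : {set 'I_(n + m).+1} :=
  match e with
  | inl e => [set gadd_lvertex m v | v in ends e]%SET
  | inr e => [set gadd_rvertex n v | v in ends e]%SET
  end.

Fact gadd_subproof n m (G : mgraph n.+1) (H : mgraph m.+1) e :
  #|@gadd_ends n m G H e| == 2.
Proof.
case: e => e; rewrite card_imset ?card_ends //; first exact: lshift_inj.
by move=> x y /cast_ord_inj/rshift_inj.
Qed.

Definition gadd n m (G : mgraph n.+1) (H : mgraph m.+1) : mgraph (n + m).+1 :=
  MGraph (@gadd_subproof n m G H).

End GraphConstructions.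

Section SubgraphTriples.
Variables (n : nat) (G : mgraph n).

(* Candidates (vertex set of C, edge set of C, alpha, r).  The parts of a
   composition of |C| and the integer r are at most |C| <= n, and there are
   at most n parts, whence the bounds below. *)
Definition ctriple : finType :=
  ({set 'I_n} * {set edge G} * n.-bseq 'I_n.+1 * 'I_n.+1)%type.

Definition cverts (c : ctriple) : {set 'I_n} := c.1.1.1.
Definition cedges (c : ctriple) : {set edge G} := c.1.1.2.
Definition calpha (c : ctriple) : seq nat := [seq val k | k <- c.1.2].
Definition cr (c : ctriple) : nat := c.2.

Definition is_component_triple (c : ctriple) : bool :=
  [&& [forall e in cedges c, ends e \subset cverts c],
      subgraph_connected (cverts c) (cedges c),
      all (leq 1) (calpha c), sumn (calpha c) == #|cverts c|
    & 0 < cr c <= head 0%N (calpha c)]%N.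

(* The sets of vertices are nonempty and pairwise disjoint, so the same
   component triple cannot be listed twice and the unordered collection is
   a set. *)
Definition ST : {set {set ctriple}} :=
  [set S : {set ctriple} |
    [&& [forall c in S, is_component_triple c],
        [forall c in S, forall d in S,
           (c != d) ==> [disjoint cverts c & cverts d]]
      & \bigcup_(c in S) cverts c == [set: 'I_n]]]%SET.

Implicit Type S : {set ctriple}.

Definition st_type S : seq nat :=
  sort geq (flatten [seq calpha c | c <- enum S]).

Definition st_sign S : Qt := (-1) ^+ (n - size (st_type S)).

Definition st_edges S : nat := (\sum_(c in S) #|cedges c|)%N.

(* For [S] in [ST], exactly one component contains [v]. *)
Definition alpha_at S (v : 'I_n) : seq nat :=
  if [pick c in S | v \in cverts c] is Some c then calpha c else [::].

Definition st_rtype S (v1 : 'I_n) : seq nat :=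
  rem (head 0%N (alpha_at S v1)) (st_type S).

End SubgraphTriples.

Section TutteMatrix.
Variables (n : nat) (G : mgraph n.+1).

(* With i and j counted from 0: ST^(i+1)(G + P_{j+1}).  The last vertex of G,
   at which the path is glued, has number n when counting from 0. *)
Definition STi (i j : nat) : {set {set ctriple (gadd G (gpath j))}} :=
  [set S in ST (gadd G (gpath j)) |
    [exists c in S, [&& ord0 \in cverts c,
                        head 0%N (calpha c) == i.+1 & cr c == 1%N]]
    && [exists c in S, [&& gadd_lvertex j ord_max \in cverts c,
                           [forall v : 'I_(n + j).+1,
                              (n <= v)%N ==> (v \in cverts c)]
                         & (j.+1 <= last 0 (calpha c))%N]]]%SET.

Definition tutte_mx : imatrix Lambda := fun i j =>
  \sum_(S in STi i j)
     (st_sign S * (-1) ^ (1 - j.+1%:Z)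
        * tvar ^ ((st_edges S)%:Z + 1 - j.+1%:Z))
       *: esym_seq Qt (st_rtype S ord0).

End TutteMatrix.

(* [H i] is the member of the family with i+1 vertices. *)

Definition graph_family := forall i : nat, mgraph i.+1.

Definition spanning_family (H : graph_family) : Prop :=
  forall i, connected_graph (H i).

Definition family_rev (H : graph_family) : graph_family := fun i => grev (H i).

Definition vvec : nat -> Lambda := fun k => k.+1%:R * esym Qt k.+1.

Definition A_mx (H : graph_family) : imatrix Lambda :=
  fun i j => ivecmul vvec (tutte_mx (H i)) j.

Definition B_mx (H : graph_family) : imatrix Lambda :=
  fun i j => tutte_mx (H j) i 0%N.

Definition K_mx (H : graph_family) : imatrix Lambda :=
  imul (itr (A_mx H)) (iinv (B_mx (family_rev H))).

(* Main.v *)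
Require Import Defs.
From mathcomp Require Import all_boot all_algebra.
From mathcomp Require Import zify ring.
From mathcomp Require boolp classical_sets functions cardinality fsbigop.

(* Write XB(G) for the first entry of v M_G: it is the sum over all subgraph
   triples, hence invariant under isomorphism of graphs.  Cutting a composition
   at its first partial sum that reaches the number of vertices on the G side
   shows that the first column of M_(G+H) is M_G times that of M_H.  Hence the
   (i,j) entry of A_H M_G B_(H'rev) is XB(H_i + G + rev(H'_j)), and reversing
   this graph transposes the matrix while exchanging H with H' and G with G_rev.
   Multiplying by the inverses of the triangular matrices B gives both claims.

   To handle the sums over subgraph triples, fix the set D of edges: the choices
   of (alpha, r) on the components of D are independent, so each entry of M_G is
   a sum over D of a product over the components of D. *)

(** The column index of M_G records an overshoot. Let C_1 be the G side of the component at the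
    glued vertex. The first partial sum that reaches |C_1| exceeds it by some k. The glued path
    supplies these k extra vertices, and the bound on the last part says that no earlier partial sum
    reaches |C_1|. On the H side the same part appears as a first part k + 1: the overshoot together
    with the shared vertex. The reduced type drops it there, so its e is counted once, and
    (-1)^(1-j) cancels its second sign.

    The vector v has entries k e_k because r takes k values when the first part is k. Multiplying by
    v therefore gives the component of vertex 1 the weight of any other component.

    Products of infinite matrices are not associative in general, and no finiteness of rows or
    columns is established for A. Every regrouping keeps A in a position where none is required,
    while M_G, B and the inverse of B have finite columns. The symmetry of A_H B_(H'rev) provides a
    second form of K, with the transposed inverse on the left; the two sides of the intertwining
    relation use one form each. *)

Set Implicit Arguments.
Unset Strict Implicit.
Unset Printing Implicit Defensive.

(** * Components of edge sets *)

Section Components.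
Variables (n : nat) (G : mgraph n).
Implicit Types (D : {set edge G}) (C : {set 'I_n}).

(** Same relation as inside [subgraph_connected], so that connectedness hypotheses apply by
    conversion. *)
Definition adj D : rel 'I_n :=
  fun x y => [exists e in D, ends e == [set x; y]].

Definition component D v : {set 'I_n} := [set u | connect (adj D) v u].

Definition components D : {set {set 'I_n}} := [set component D v | v : 'I_n].

Definition inner_edges D C : {set edge G} := [set e in D | ends e \subset C].

Definition saturated D C : Prop :=
  forall e x y, e \in D -> x \in ends e -> y \in ends e -> x \in C -> y \in C.

Lemma ends_pair (e : edge G) x y :
  x \in ends e -> y \in ends e -> x != y -> ends e = [set x; y].
Proof.
move=> xe ye xy; apply/eqP; rewrite eq_sym eqEcard cards2 xy.
rewrite (eqP (card_ends e)) leqnn andbT.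
by apply/subsetP=> z; rewrite !inE => /orP[]/eqP->.
Qed.

Lemma ends_inhabited (e : edge G) : exists x, x \in ends e.
Proof.
have : 0 < #|ends e| by rewrite (eqP (card_ends e)).
by case/card_gt0P => x; exists x.
Qed.

Lemma connect_ends D (e : edge G) x y :
  e \in D -> x \in ends e -> y \in ends e -> connect (adj D) x y.
Proof.
move=> eD xe ye; have [->|xy] := eqVneq x y; first exact: connect0.
apply: connect1; apply/existsP; exists e; rewrite eD /=.
by apply/eqP/ends_pair.
Qed.

Lemma adj_sym D : symmetric (adj D).
Proof. by move=> x y; apply: eq_existsb => e; rewrite setUC. Qed.

Lemma connect_adj_sym D : connect_sym (adj D).
Proof. exact/sym_connect_sym/adj_sym. Qed.

Lemma connect_saturated D C x y :
  saturated D C -> connect (adj D) x y -> x \in C -> y \in C.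
Proof.
move=> satC /connectP[p]; elim: p x => [|z p IHp] x /= => [_ -> //|].
case/andP=> /existsP[e /andP[eD /eqP exz]] zp yE xC.
apply: IHp zp yE _; apply: satC eD _ _ xC; by rewrite exz !inE eqxx ?orbT.
Qed.

Lemma component_saturated D v : saturated D (component D v).
Proof.
move=> e x y eD xe ye; rewrite !inE => vx.
exact: connect_trans vx (connect_ends eD xe ye).
Qed.

Lemma mem_component D v : v \in component D v.
Proof. by rewrite inE connect0. Qed.

Lemma component_in_components D v : component D v \in components D.
Proof. exact: imset_f. Qed.

(** The criterion by which components are identified below: saturation bounds the component from
    above, connectedness from below. *)
Lemma component_eqP D C v :
  v \in C -> saturated D C -> (forall u, u \in C -> connect (adj D) v u) ->
  component D v = C.
Proof.
move=> vC satC conC; apply/setP=> u; rewrite inE; apply/idP/idP; last exact: conC.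
by move=> vu; apply: connect_saturated satC vu vC.
Qed.

Lemma component_eq D u v : u \in component D v -> component D u = component D v.
Proof.
rewrite inE => vu; apply/setP=> w; rewrite !inE.
by rewrite (same_connect (@connect_adj_sym D) vu).
Qed.

Lemma components_eq D C v : C \in components D -> v \in C -> C = component D v.
Proof. by case/imsetP => u _ -> /component_eq. Qed.

Lemma components_disjoint D C C' v :
  C \in components D -> C' \in components D -> v \in C -> v \in C' -> C = C'.
Proof. by move=> CP C'P vC vC'; rewrite (components_eq CP vC) -(components_eq C'P vC'). Qed.

Lemma components_inhabited D C : C \in components D -> exists v, v \in C.
Proof. by case/imsetP => v _ ->; exists v; exact: mem_component. Qed.

Lemma card_components_gt0 D C : C \in components D -> 0 < #|C|.
Proof. by case/components_inhabited => v vC; apply/card_gt0P; exists v. Qed.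

Lemma ends_sub_component D (e : edge G) x : e \in D -> x \in ends e -> ends e \subset component D x.
Proof.
by move=> eD xe; apply/subsetP=> y ye; apply: component_saturated eD xe ye (mem_component D x).
Qed.

Lemma sum_inner_edges D : \sum_(C in components D) #|inner_edges D C| = #|D|.
Proof.
under eq_bigr do rewrite -sum1_card.
rewrite (exchange_big_dep (fun e => e \in D)) /=; last first.
  by move=> C e _; rewrite inE => /andP[].
rewrite -sum1_card; apply: eq_bigr => e eD; have [x xe] := ends_inhabited e.
rewrite (bigD1 (component D x)) /=; last first.
  by rewrite component_in_components inE eD ends_sub_component.
rewrite big1 // => C /andP[/andP[CP]]; rewrite inE => /andP[_ /subsetP eC] /eqP[].
exact: components_eq (eC _ xe).
Qed.

Lemma connect_inner_edges D C u v :
  C \in components D -> u \in C -> v \in C -> connect (adj (inner_edges D C)) u v.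
Proof.
move=> CP uC vC; have CE := components_eq CP uC; rewrite CE in vC *.
rewrite inE in vC.
(* Saturation is for all of D: an edge of D that meets the component of u lies inside it, hence is
   already an inner edge. *)
have sat : saturated D (component (inner_edges D (component D u)) u).
  move=> e x y eD xe ye; rewrite !inE => ux.
  have xu : x \in component D u.
    rewrite inE; apply: connect_sub ux => z w.
    case/existsP=> e' /andP[]; rewrite inE => /andP[e'D _] ezw.
    by apply: connect1; apply/existsP; exists e'; rewrite e'D.
  apply: (connect_trans ux); apply: (connect_ends _ xe ye).
  by rewrite inE eD /= -(component_eq xu) ends_sub_component.
by have := connect_saturated sat vC (mem_component _ u); rewrite inE.
Qed.

End Components.

(** * Subgraph triples as edge sets with labelled components *)

Section SumOverSubgraphTriples.
Local Open Scope ring_scope.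
Import GRing.Theory.
Variables (n : nat) (G : mgraph n) (R : comNzRingType).

(** The data (alpha, r), with the bounds of [ctriple]. Which labels are admissible depends on C only
    through its size. *)
Definition label : finType := (n.-bseq 'I_n.+1 * 'I_n.+1)%type.

Definition mk_ctriple (C : {set 'I_n}) (D : {set edge G}) (l : label) : ctriple G :=
  (C, D, l.1, l.2).

Definition labels_of (c : nat) : {set label} := 
  [set l : label | [&& all (leq 1) [seq val k | k <- l.1],
     sumn [seq val k | k <- l.1] == c
    & 0 < l.2 <= head 0%N [seq val k | k <- l.1]]%N].

Definition st_edge_set (S : {set ctriple G}) : {set edge G} :=
  \bigcup_(c in S) cedges c.

Lemma is_component_tripleE C D l :
  is_component_triple (mk_ctriple C D l) =
  [&& [forall e in D, ends e \subset C], subgraph_connected C D & l \in labels_of #|C|].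
Proof. by rewrite inE. Qed.

Section Decompose.
Variable S : {set ctriple G}.
Hypothesis ST_S : S \in ST G.

Let D := st_edge_set S.

Lemma ST_component c : c \in S -> is_component_triple c.
Proof. by move: ST_S; rewrite inE => /and3P[/forall_inP + _ _]; apply. Qed.

Lemma ST_eq c d v : c \in S -> d \in S -> v \in cverts c -> v \in cverts d -> c = d.
Proof.
move=> cS dS vc vd; apply/eqP/negPn/negP => cd.
move: ST_S; rewrite inE => /and3P[_ /forall_inP/(_ c cS)/forall_inP/(_ d dS) + _].
by rewrite cd /= => /pred0P/(_ v) /=; rewrite vc vd.
Qed.

Lemma ST_cover v : exists2 c, c \in S & v \in cverts c.
Proof.
have : v \in \bigcup_(c in S) cverts c.
  by move: ST_S; rewrite inE => /and3P[_ _ /eqP->]; rewrite inE.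
by case/bigcupP => c; exists c.
Qed.

(** An edge of D belongs to some triple of S; if it meets [cverts c], disjointness forces that
    triple to be c, so D has no edge leaving [cverts c]. *)
Lemma component_ST c v : c \in S -> v \in cverts c -> component D v = cverts c.
Proof.
move=> cS vc; have /and5P[eP conC _ _ _] := ST_component cS; apply: component_eqP => //.
- move=> e x y /bigcupP[d dS ed] xe ye xc.
  have /and5P[/forall_inP/(_ e ed)/subsetP ed' _ _ _ _] := ST_component dS.
  by rewrite (ST_eq cS dS xc (ed' x xe)) ed'.
- move=> u uc; case/andP: conC => _ /forall_inP/(_ v vc)/forall_inP/(_ u uc).
  apply: connect_sub => x y /existsP[e /andP[ec exy]].
  apply: connect1; apply/existsP; exists e; rewrite exy andbT.
  by apply/bigcupP; exists c.
Qed.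

Lemma ST_inhabited c : c \in S -> exists v, v \in cverts c.
Proof. by move=> /ST_component/and5P[_ /andP[/set0Pn]]. Qed.

Lemma ST_inner_edges c : c \in S -> cedges c = inner_edges D (cverts c).
Proof.
move=> cS; have /and5P[/forall_inP eP _ _ _ _] := ST_component cS.
apply/setP=> e; rewrite inE; apply/idP/andP => [ec|[/bigcupP[d dS ed] /subsetP ec]].
  by split; [apply/bigcupP; exists c | apply: eP].
have [x xe] := ends_inhabited e.
have /and5P[/forall_inP/(_ e ed)/subsetP ed' _ _ _ _] := ST_component dS.
by rewrite (ST_eq cS dS (ec _ xe) (ed' _ xe)).
Qed.

Lemma components_ST : components D = [set cverts c | c in S].
Proof.
apply/setP=> C; apply/imsetP/imsetP => [[v _ ->]|[c cS ->]].
  by have [c cS vc] := ST_cover v; exists c; rewrite // (component_ST cS vc).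
by have [v vc] := ST_inhabited cS; exists v; rewrite // (component_ST cS vc).
Qed.

Lemma ST_label c : c \in S -> (c.1.2, c.2) \in labels_of #|cverts c|.
Proof.
move=> cS; have := ST_component cS.
by case: c cS => [[[C E] a] r] cS; rewrite (is_component_tripleE C E (a, r)) => /and3P[].
Qed.

End Decompose.

(** Value of a labelling off the components of D. Fixing it makes a labelling determined by its
    subgraph triple. *)
Definition default_label : label := ([bseq], ord0).

Definition st_of (D : {set edge G}) (f : {ffun {set 'I_n} -> label}) : {set ctriple G} :=
  [set mk_ctriple C (inner_edges D C) (f C) | C in components D].

Definition label_fun (S : {set ctriple G}) : {ffun {set 'I_n} -> label} :=
  [ffun C => if [pick c in S | cverts c == C] is Some c then (c.1.2, c.2) else default_label].

Lemma label_funE S c : S \in ST G -> c \in S -> label_fun S (cverts c) = (c.1.2, c.2).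
Proof.
move=> ST_S cS; rewrite ffunE; case: pickP => [d /andP[dS /eqP dc]|/(_ c)]; last first.
  by rewrite cS eqxx.
have [v vc] := ST_inhabited ST_S cS.
by rewrite (ST_eq ST_S dS cS _ vc) // dc.
Qed.

Lemma label_fun_family S : S \in ST G ->
  label_fun S \in pfamily default_label (fun C => C \in components (st_edge_set S))
    (fun (C : {set 'I_n}) (l : label) => l \in labels_of #|C|).
Proof.
move=> ST_S; apply/pfamilyP; split=> [|C].
  apply/supportP=> C; rewrite unfold_in /= components_ST // ffunE.
  by case: pickP => // c /andP[cS /eqP <-]; rewrite imset_f.
rewrite unfold_in /= components_ST // => /imsetP[c cS ->].
by rewrite unfold_in label_funE //; exact: ST_label cS.
Qed.

Lemma label_funK S : S \in ST G -> st_of (st_edge_set S) (label_fun S) = S.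
Proof.
move=> ST_S; rewrite /st_of components_ST // -imset_comp -[RHS]imset_id.
apply: eq_in_imset => c cS /=; rewrite label_funE // -ST_inner_edges //.
by case: c cS => [[[]]].
Qed.

Section Recompose.
Variables (D : {set edge G}) (f : {ffun {set 'I_n} -> label}).
Hypothesis fP : f \in pfamily default_label (fun C => C \in components D)
  (fun (C : {set 'I_n}) (l : label) => l \in labels_of #|C|).

Lemma st_of_ST : st_of D f \in ST G.
Proof.
have /pfamilyP[_ fP'] := fP; rewrite inE; apply/and3P; split.
- apply/forall_inP=> _ /imsetP[C CD ->]; rewrite is_component_tripleE (fP' C) // andbT.
  apply/andP; split; first by apply/forall_inP=> e; rewrite inE => /andP[].
  apply/andP; split; first by apply/set0Pn/(components_inhabited CD).
  by apply/forall_inP=> u uC; apply/forall_inP=> v vC; apply: connect_inner_edges.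
- apply/forall_inP=> _ /imsetP[C CD ->]; apply/forall_inP=> _ /imsetP[C' C'D ->].
  apply/implyP=> ne; apply/pred0P=> v /=; apply/negP=> /andP[vC vC'].
  by case/eqP: ne; rewrite (components_disjoint CD C'D vC vC').
- apply/eqP/setP=> v; rewrite [RHS]inE; apply/bigcupP.
  exists (mk_ctriple (component D v) (inner_edges D (component D v)) (f (component D v))).
    by apply/imsetP; exists (component D v); rewrite ?component_in_components.
  exact: mem_component.
Qed.

Lemma st_of_edges : st_edge_set (st_of D f) = D.
Proof.
apply/setP=> e; apply/bigcupP/idP => [[_ /imsetP[C CD ->]]|eD].
  by rewrite inE => /andP[].
have [x xe] := ends_inhabited e.
exists (mk_ctriple (component D x) (inner_edges D (component D x)) (f (component D x))).
  by apply/imsetP; exists (component D x); rewrite ?component_in_components.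
by rewrite inE eD ends_sub_component.
Qed.

Lemma st_ofK : label_fun (st_of D f) = f.
Proof.
apply/ffunP=> C; have /pfamilyP[/supportP fs _] := fP.
have [CD|CD] := boolP (C \in components D).
  rewrite (@label_funE _ (mk_ctriple C (inner_edges D C) (f C)) st_of_ST) //.
    by rewrite /mk_ctriple; case: (f C).
  exact: imset_f.
rewrite fs // ffunE; case: pickP => // _ /andP[/imsetP[C' C'D ->] /eqP CE].
by rewrite -CE C'D in CD.
Qed.

End Recompose.

Lemma sum_ST (w : ctriple G -> R) :
  \sum_(S in ST G) \prod_(c in S) w c =
  \sum_(D : {set edge G}) \prod_(C in components D)
     \sum_(l in labels_of #|C|) w (mk_ctriple C (inner_edges D C) l).
Proof.
rewrite (partition_big st_edge_set predT) //=; apply: eq_bigr => D _.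
rewrite (big_distr_big_dep default_label) /=.
(* Between labellings of the components of D and subgraph triples with edge set D, [st_of D] and
   [label_fun] are inverse bijections. *)
rewrite (reindex_onto (st_of D) label_fun) /=; last first.
  by move=> S /andP[ST_S /eqP <-]; exact: label_funK.
apply: eq_big => [f|f _].
  apply/idP/idP=> [/andP[/andP[ST_S /eqP DE] /eqP <-]|fP].
    by have := label_fun_family ST_S; rewrite DE.
  by rewrite st_of_ST // st_of_edges // st_ofK ?eqxx.
rewrite /st_of big_imset //= => C C' _ _ CE.
by have := congr1 (@cverts _ _) CE.
Qed.

End SumOverSubgraphTriples.

(** * Gluing two graphs *)

Section Gluing.
Variables (n m : nat) (G : mgraph n.+1) (H : mgraph m.+1).

Let l : 'I_n.+1 -> 'I_(n + m).+1 := @gadd_lvertex n m.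
Let r : 'I_m.+1 -> 'I_(n + m).+1 := @gadd_rvertex n m.

Lemma gadd_lvertex_inj : injective l.
Proof. exact: lshift_inj. Qed.

Lemma gadd_rvertex_inj : injective r.
Proof. by move=> x y /cast_ord_inj/rshift_inj. Qed.

Lemma gadd_glue : l ord_max = r ord0.
Proof. by apply: val_inj; rewrite /= addn0. Qed.

Lemma gadd_vertex_eq x y : l x = r y -> x = ord_max /\ y = ord0.
Proof.
move=> /(congr1 val) /= xy; have := ltn_ord x.
by split; apply: val_inj => /=; lia.
Qed.

Lemma gadd_vertexP v : (exists x, v = l x) \/ (exists y, v = r y).
Proof.
have [vn|nv] := leqP v n.
  by left; exists (inord v); apply: val_inj; rewrite /= inordK.
right; exists (inord (v - n)); apply: val_inj; rewrite /= inordK; have := ltn_ord v; lia.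
Qed.

Definition edge_sum (D1 : {set edge G}) (D2 : {set edge H}) : {set edge (gadd G H)} :=
  [set x | match x with inl e => e \in D1 | inr e => e \in D2 end].

Lemma card_edge_sum D1 D2 : #|edge_sum D1 D2| = #|D1| + #|D2|.
Proof.
rewrite -!sum1_card big_sumType /=; congr (_ + _);
  by apply: eq_bigl => e; rewrite inE.
Qed.

Lemma sum_edge_sets (R : nmodType) (F : {set edge (gadd G H)} -> R) :
  (\sum_D F D = \sum_D1 \sum_D2 F (edge_sum D1 D2))%R.
Proof.
rewrite pair_big /=.
pose un (D : {set edge (gadd G H)}) := (inl @^-1: D, inr @^-1: D) : {set edge G} * {set edge H}.
apply: (reindex (fun p => edge_sum p.1 p.2)); exists un => /= [[D1 D2] _|D _].
  by congr (_, _); apply/setP=> e; rewrite !inE.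
by apply/setP=> -[] e; rewrite !inE.
Qed.

Section Components.
Variables (D1 : {set edge G}) (D2 : {set edge H}).
Let D := edge_sum D1 D2.
Let C1 := component D1 ord_max.
Let C2 := component D2 ord0.

Lemma connect_l x y : connect (adj D1) x y -> connect (adj D) (l x) (l y).
Proof.
case/connectP=> p; elim: p x => [|z p IHp] x /= => [_ ->|]; first exact: connect0.
case/andP=> /existsP[e /andP[eD /eqP exz]] /IHp zy /zy; apply: connect_trans.
by apply: (@connect_ends _ (gadd G H) D (inl e)); first (by rewrite inE);
  apply: imset_f; rewrite exz !inE eqxx ?orbT.
Qed.

Lemma connect_r x y : connect (adj D2) x y -> connect (adj D) (r x) (r y).
Proof.
case/connectP=> p; elim: p x => [|z p IHp] x /= => [_ ->|]; first exact: connect0.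
case/andP=> /existsP[e /andP[eD /eqP exz]] /IHp zy /zy; apply: connect_trans.
by apply: (@connect_ends _ (gadd G H) D (inr e)); first (by rewrite inE);
  apply: imset_f; rewrite exz !inE eqxx ?orbT.
Qed.

(** An edge of one summand meets the image of the other only at the glued vertex, where the two sets
    are required to agree. *)
Lemma saturated_edge_sum (A1 : {set 'I_n.+1}) (A2 : {set 'I_m.+1}) :
  saturated D1 A1 -> saturated D2 A2 -> (ord_max \in A1) = (ord0 \in A2) ->
  saturated D (l @: A1 :|: r @: A2).
Proof.
move=> sat1 sat2 A12 [] e x y; rewrite inE => eD /imsetP[x' xe ->] /imsetP[y' ye ->].
- rewrite -/l !inE => xA; apply/orP; left; apply: imset_f; apply: sat1 eD xe ye _.
  case/orP: xA => /imsetP[z zA]; first by move/gadd_lvertex_inj ->.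
  by case/gadd_vertex_eq => -> z0; rewrite A12 -z0.
- rewrite -/r !inE => xA; apply/orP; right; apply: imset_f; apply: sat2 eD xe ye _.
  case/orP: xA => /imsetP[z zA]; last by move/gadd_rvertex_inj ->.
  by move/esym/gadd_vertex_eq => [z0 ->]; rewrite -A12 -z0.
Qed.

(** With the empty set on one side, [saturated_edge_sum] also covers the components that avoid the
    glued vertex. *)
Lemma saturated0 k (K : mgraph k) (E : {set edge K}) : saturated E set0.
Proof. by move=> e x y _ _ _; rewrite inE. Qed.

Lemma component_l v : v \notin C1 -> component D (l v) = l @: component D1 v.
Proof.
move=> vC; apply: component_eqP; first by rewrite imset_f // mem_component.
  have := @saturated_edge_sum (component D1 v) set0
    (@component_saturated _ _ D1 v) (@saturated0 _ _ _).
  rewrite imset0 setU0; apply; rewrite [RHS]inE; apply: contraNF vC => maxv.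
  by rewrite /C1 (component_eq maxv) mem_component.
by move=> _ /imsetP[u uv ->]; apply: connect_l; rewrite inE in uv.
Qed.

Lemma component_r v : v \notin C2 -> component D (r v) = r @: component D2 v.
Proof.
move=> vC; apply: component_eqP; first by rewrite imset_f // mem_component.
  have := @saturated_edge_sum set0 (component D2 v) (@saturated0 _ _ _)
    (@component_saturated _ _ D2 v).
  rewrite imset0 set0U; apply; rewrite [LHS]inE; apply/esym; apply: contraNF vC => v0.
  by rewrite /C2 (component_eq v0) mem_component.
by move=> _ /imsetP[u uv ->]; apply: connect_r; rewrite inE in uv.
Qed.

Lemma component_glue : component D (l ord_max) = l @: C1 :|: r @: C2.
Proof.
apply: component_eqP; first by rewrite inE imset_f // mem_component.
  by apply: saturated_edge_sum; rewrite ?mem_component //; apply: component_saturated.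
move=> _ /setUP[] /imsetP[u uC ->].
  by apply: connect_l; rewrite inE in uC.
by rewrite gadd_glue; apply: connect_r; rewrite inE in uC.
Qed.

(** Only the two components at the glued vertex merge; all others are carried over unchanged. *)
Lemma components_edge_sum :
  components D = (l @: C1 :|: r @: C2) |:
    ([set l @: C | C : {set 'I_n.+1} in components D1 :\ C1]
     :|: [set r @: C | C : {set 'I_m.+1} in components D2 :\ C2]).
Proof.
apply/setP=> C; apply/imsetP/setU1P => [[v _ ->{C}]|[->|/setUP[]]]; last first.
- case/imsetP=> A /setD1P[AC /imsetP[v _ AE]] ->; exists (r v) => //.
  by rewrite component_r -?AE //; apply: contraNN AC => /component_eq; rewrite AE => ->.
- case/imsetP=> A /setD1P[AC /imsetP[v _ AE]] ->; exists (l v) => //.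
  by rewrite component_l -?AE //; apply: contraNN AC => /component_eq; rewrite AE => ->.
- by exists (l ord_max); rewrite // component_glue.
have glued v' : v' \in l @: C1 :|: r @: C2 -> component D v' = l @: C1 :|: r @: C2.
  by rewrite -component_glue => /component_eq.
case: (gadd_vertexP v) => -[x ->].
  have [xC|xC] := boolP (x \in C1); first by left; rewrite glued // inE imset_f.
  right; rewrite component_l // inE imset_f // !inE component_in_components andbT.
  by apply: contraNneq xC => <-; exact: mem_component.
have [xC|xC] := boolP (x \in C2); first by left; rewrite glued // inE imset_f ?orbT.
right; rewrite component_r // inE orbC imset_f // !inE component_in_components andbT.
by apply: contraNneq xC => <-; exact: mem_component.
Qed.

Lemma card_glued : #|l @: C1 :|: r @: C2| = #|C1| + #|C2|.-1.
Proof.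
have := cardsUI (l @: C1) (r @: C2).
have -> : l @: C1 :&: r @: C2 = [set l ord_max].
  apply/setP=> v; rewrite !inE; apply/andP/eqP => [[/imsetP[x _ ->] /imsetP[y _]]|->].
    by case/gadd_vertex_eq => ->.
  by rewrite imset_f ?mem_component // gadd_glue imset_f ?mem_component.
rewrite cards1 (card_imset _ gadd_lvertex_inj) (card_imset _ gadd_rvertex_inj).
have C2_gt0 : 0 < #|C2| by apply/card_gt0P; exists ord0; apply: mem_component.
by move=> UI; apply: (@addIn 1); rewrite UI -addnA addn1 prednK.
Qed.

Lemma prod_components_edge_sum (R : comNzRingType) (F : {set 'I_(n + m).+1} -> R) :
  (\prod_(C in components D) F C =
   F (l @: C1 :|: r @: C2) *
   (\prod_(C in components D1 :\ C1) F (l @: C) * \prod_(C in components D2 :\ C2) F (r @: C)))%R.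
Proof.
rewrite components_edge_sum big_setU1 /=; last first.
  apply/negP=> /setUP[] /imsetP[C CP CE].
    have /setD1P[/eqP + CD] := CP; apply.
    rewrite (components_eq CD (v := ord_max)) // -(mem_imset _ _ gadd_lvertex_inj) -CE.
    by rewrite inE imset_f ?mem_component.
  have /setD1P[/eqP + CD] := CP; apply.
  rewrite (components_eq CD (v := ord0)) // -(mem_imset _ _ gadd_rvertex_inj) -CE.
  by rewrite !inE [_ \in r @: _]imset_f ?mem_component ?orbT.
congr (_ * _)%R; rewrite (eq_bigl [predU [set l @: C | C : {set 'I_n.+1} in components D1 :\ C1] &
  [set r @: C | C : {set 'I_m.+1} in components D2 :\ C2]]); last by move=> C; rewrite !inE.
(* A common member of both families would contain the glued vertex, but the components of that
   vertex were removed. *)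
rewrite bigU /=; last first.
  apply/pred0P=> C /=; apply/negP=> /andP[/imsetP[A AP ->] /imsetP[B BP AB]].
  have /setD1P[/eqP AC AD] := AP; have [a aA] := components_inhabited AD.
  have : l a \in r @: B by rewrite -AB imset_f.
  case/imsetP=> b bB /gadd_vertex_eq[aE _]; apply: AC.
  by apply: components_eq; rewrite // -aE.
by congr (_ * _)%R; rewrite big_imset //= => A B _ _ /imset_inj;
  apply; [exact: gadd_lvertex_inj|exact: gadd_rvertex_inj].
Qed.

End Components.

End Gluing.

(** * Edge sets of a path *)

Section Path.
Variable j : nat.

Lemma component_path : component [set: edge (gpath j)] ord0 = setT.
Proof.
apply: component_eqP => // -[k kj] _.
elim: k kj => [|k IHk] kj.
  by rewrite (_ : Ordinal kj = ord0) ?connect0 //; apply: val_inj.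
have kj' : k < j by [].
apply: connect_trans (IHk (leqW kj')) _.
apply: (@connect_ends _ (gpath j) _ (Ordinal kj')); rewrite ?inE //.
  by apply/orP; left; apply/eqP/val_inj.
by apply/orP; right; apply/eqP/val_inj.
Qed.

Lemma notin_component_path (D : {set edge (gpath j)}) (k : 'I_j) :
  k \notin D -> lift ord0 k \notin component D ord0.
Proof.
move=> kD; rewrite inE; apply/negP => c0.
(* Only the missing edge k leaves the initial segment up to k, so D saturates this segment. *)
have : lift ord0 k \in [set v : 'I_j.+1 | v <= k].
  apply: connect_saturated c0 _; last by rewrite inE.
  move=> e x y eD; rewrite !inE => xe ye xk.
  have ek : e != k :> nat by apply: contraNneq kD => /val_inj <-.
  by move: xe ye => /orP[]/eqP xE /orP[]/eqP yE; move: xk ek; rewrite xE yE /= /bump ?leq0n; lia.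
by rewrite inE /= /bump /= add1n ltnn.
Qed.

End Path.

(** * Sums over compositions *)

(* [k] is fuel. *)
Fixpoint compositions_upto k c : seq (seq nat) :=
  if c is 0 then [:: [::]] else
  if k is k'.+1 then
    [seq i.+1 :: a | i <- iota 0 c, a <- compositions_upto k' (c - i.+1)]
  else [::].

Definition compositions c := compositions_upto c c.

Lemma mem_compositions_upto k c (a : seq nat) : c <= k ->
  (a \in compositions_upto k c) = all (leq 1) a && (sumn a == c).
Proof.
elim: k c a => [|k IHk] [|c] a //.
- by case: a => [|[|x] a] //=; rewrite andbF.
- by case: a => [|[|x] a] //=; rewrite andbF.
move=> ck; rewrite /compositions_upto -/compositions_upto; apply/allpairsPdep/idP.
  case=> i [b [+ + ->]]; rewrite mem_iota /= IHk; last by lia.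
  by move=> ic /andP[b1 /eqP bs]; rewrite b1 /=; lia.
case: a => [|[|x] a] //= /andP[a1 /eqP xa]; exists x, a; split=> //.
  by rewrite -[0 :: _]/(iota 0 c.+1) mem_iota /=; lia.
by have := IHk (c.+1 - x.+1) a; rewrite a1 /= => ->; lia.
Qed.

Lemma compositions_upto_uniq k c : uniq (compositions_upto k c).
Proof.
elim: k c => [|k IHk] [|c] //; rewrite /compositions_upto -/compositions_upto.
apply: allpairs_uniq_dep => [|i _|]; [exact: iota_uniq|exact: IHk|].
by move=> [i a] [j b] /= _ _ [-> ->].
Qed.

Lemma mem_compositions c (a : seq nat) :
  (a \in compositions c) = all (leq 1) a && (sumn a == c).
Proof. exact: mem_compositions_upto. Qed.

Lemma compositions_uniq c : uniq (compositions c).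
Proof. exact: compositions_upto_uniq. Qed.

Lemma size_composition c a : a \in compositions c -> size a <= c.
Proof.
rewrite mem_compositions => /andP[a1 /eqP <-].
by elim: a a1 => //= x a IHa /andP[x1 /IHa]; lia.
Qed.

Local Open Scope ring_scope.
Import GRing.Theory.

Section CompositionSums.
Variables (R : comNzRingType) (e : nat -> R).
Implicit Type f : nat -> R.

Lemma sum_compositionsS c (F : seq nat -> R) :
  \sum_(a <- compositions c.+1) F a =
  \sum_(i < c.+1) \sum_(a <- compositions (c - i)) F (i.+1 :: a).
Proof.
rewrite [LHS]big_allpairs_dep -[iota 0 c.+1]/(index_iota 0 c.+1) big_mkord.
(* The two enumerations of the tails use different fuel, so they are compared up to permutation. *)
apply: eq_bigr => i _; apply: perm_big; apply: uniq_perm => [||a].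
- exact: compositions_upto_uniq.
- exact: compositions_uniq.
by rewrite mem_compositions mem_compositions_upto // subSS leq_subr.
Qed.

Lemma sum_compositions0 (F : seq nat -> R) :
  \sum_(a <- compositions 0) F a = F [::].
Proof. by rewrite big_seq1. Qed.

(* The contribution of a component with [c] vertices: [f] accounts for the first
   part together with r, and [j] for the bound on the last part ([j = 0] gives
   no condition). *)
Definition esum_last j f c : R :=
  \sum_(a <- compositions c)
    (j <= last 0%N a)%:R * (-1) ^+ (c - size a)
    * (f (head 0%N a) * \prod_(k <- behead a) e k).

(** For [e] the elementary symmetric functions, this is the expansion of the complete homogeneous
    function h_c. *)
Definition hsum c : R :=
  \sum_(a <- compositions c) (-1) ^+ (c - size a) * \prod_(k <- a) e k.

Lemma esum_last_recl f c :
  esum_last 0 f c.+1 = \sum_(i < c.+1) (-1) ^+ i * f i.+1 * hsum (c - i).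
Proof.
rewrite /esum_last sum_compositionsS; apply: eq_bigr => i _.
rewrite mulr_sumr; apply: eq_big_seq => a /size_composition ai /=.
rewrite mul1r subSS; have -> : (c - size a = i + (c - i - size a))%N by have := ltn_ord i; lia.
by rewrite exprD; ring.
Qed.

Lemma hsum0 : hsum 0 = 1.
Proof. by rewrite /hsum sum_compositions0 big_nil mulr1. Qed.

Lemma hsumS c : hsum c.+1 = esum_last 0 e c.+1.
Proof.
apply: eq_big_seq => a; rewrite mem_compositions => /andP[_].
by case: a => [|x a] //= _; rewrite mul1r big_cons.
Qed.

Lemma esum_last_small j f c : (c < j)%N -> esum_last j f c = 0.
Proof.
move=> cj; rewrite /esum_last big_seq big1 // => a; rewrite mem_compositions.
move=> /andP[_ /eqP sa]; suff -> : (j <= last 0%N a)%N = false by rewrite !mul0r.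
apply/negbTE; rewrite -ltnNge; apply: leq_ltn_trans cj; rewrite -sa.
by case/lastP: a {sa} => // a x; rewrite last_rcons sumn_rcons leq_addl.
Qed.

Lemma esum_last_gt0 f c : esum_last 1 f c.+1 = esum_last 0 f c.+1.
Proof.
apply: eq_big_seq => a; rewrite mem_compositions => /andP[a1 /eqP sa].
suff -> : (1 <= last 0%N a)%N by [].
by case/lastP: a a1 sa => // a x; rewrite all_rcons last_rcons => /andP[].
Qed.

(** Either there is a single part, or the first part i + 1 leaves a tail under the same bound. The
    tail needs at least k + 1 vertices, whence i < a. *)
Lemma esum_last_rec k f a :
  esum_last k.+1 f (a + k).+1 =
  (-1) ^+ (a + k) * f (a + k).+1
  + \sum_(i < a) (-1) ^+ i * f i.+1 * esum_last k.+1 e (a - i.+1 + k).+1.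
Proof.
rewrite /esum_last sum_compositionsS big_ord_recr /= addrC; congr (_ + _).
  rewrite subnn sum_compositions0 big_nil !mulr1 /= subSS subn0.
  by rewrite ltnS leq_addl mul1r.
have step (i : 'I_(a + k)) :
  \sum_(b <- compositions (a + k - i))
    (k < last i.+1 b)%N%:R * (-1) ^+ ((a + k).+1 - (size b).+1)
      * (f i.+1 * \prod_(l <- b) e l)
  = (-1) ^+ i * f i.+1 * esum_last k.+1 e (a + k - i).
  rewrite mulr_sumr; apply: eq_big_seq => b bP; have := size_composition bP.
  move: bP; rewrite mem_compositions => /andP[_].
  case: b => [|x b] /=; first by have := ltn_ord i; lia.
  move=> _ bi; have -> : ((a + k).+1 - (size b).+2 = i + (a + k - i - (size b).+1))%N.
    by move: bi (ltn_ord i); move: (size b) => s; lia.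
  by rewrite big_cons exprD; ring.
rewrite (eq_bigr _ (fun i _ => step i)) big_split_ord /= addrC big1 ?add0r.
  apply: eq_bigr => i _; congr (_ * esum_last _ _ _).
  by have := ltn_ord i; lia.
by move=> i _; rewrite esum_last_small ?mulr0 //; have := ltn_ord i; lia.
Qed.

(* Splits a composition of a+b+1 at its first partial sum exceeding a, which is
   written a+k+1. *)
Lemma esum_last_split f a b :
  esum_last 0 f (a + b).+1 =
  \sum_(k < b.+1) esum_last k.+1 f (a + k).+1 * hsum (b - k).
Proof.
(* A first part exceeding a is the whole initial piece. Otherwise the tail is an instance with
   smaller a and with [e] in place of [f], so [f] must be general. *)
elim/ltn_ind: a f => a IHa f.
under [RHS]eq_bigr do rewrite esum_last_rec mulrDl mulr_suml.
rewrite big_split /= exchange_big /= addrC.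
rewrite esum_last_recl -addnS big_split_ord /=; congr (_ + _).
  apply: eq_bigr => i _; under [RHS]eq_bigr do rewrite -[_ * _ * hsum _]mulrA.
  rewrite -mulr_sumr -IHa; last by have := ltn_ord i; lia.
  rewrite -hsumS; congr (_ * hsum _); have := ltn_ord i; lia.
by apply: eq_bigr => i _; congr (_ * hsum _); lia.
Qed.

Lemma esum_last_delta k b :
  esum_last 0 (fun i => (i == k.+1)%:R) b.+1 =
  if (k <= b)%N then (-1) ^+ k * hsum (b - k) else 0.
Proof.
rewrite esum_last_recl; case: leqP => kb.
  rewrite (bigD1 (Ordinal (kb : (k < b.+1)%N))) //= eqxx mulr1 big1 ?addr0 // => i ik.
  by rewrite eqSS -[_ == k]/(i == Ordinal (kb : (k < b.+1)%N)) (negbTE ik) mulr0 mul0r.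
rewrite big1 // => i _; rewrite eqSS (_ : _ == k = false) ?mulr0 ?mul0r //.
by have := ltn_ord i; lia.
Qed.

Lemma esum_last_linear (I : finType) (u : I -> R) (f : I -> nat -> R) j c :
  esum_last j (fun k => \sum_i u i * f i k) c = \sum_i u i * esum_last j (f i) c.
Proof.
under [RHS]eq_bigr do rewrite mulr_sumr.
rewrite exchange_big; apply: eq_bigr => a _ /=.
rewrite mulr_suml mulr_sumr; apply: eq_bigr => i _; ring.
Qed.

Lemma eq_esum_last f f' j c : (forall k, 0 < k <= c -> f k = f' k)%N -> (0 < c)%N ->
  esum_last j f c = esum_last j f' c.
Proof.
move=> ff' c0; apply: eq_big_seq => a; rewrite mem_compositions.
case: a => [|x a] /andP[a1 /eqP ac]; first by rewrite -ac in c0.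
by case/andP: a1 => x0 _ /=; rewrite ff' // x0 -ac leq_addr.
Qed.

(** The bounds in the encoding lose nothing: a composition of c <= n has at most n parts, each at
    most n. *)
Lemma sum_labels n c (F : seq nat -> nat -> R) : (c <= n)%N ->
  \sum_(l in labels_of n c) F [seq val k | k <- l.1] (val l.2) =
  \sum_(a <- compositions c) \sum_(1 <= r < (head 0%N a).+1) F a r.
Proof.
move=> cn; pose f (b : n.-bseq 'I_n.+1) := [seq val k | k <- b].
pose P (a : seq nat) := all (leq 1) a && (sumn a == c).
transitivity (\sum_(b | P (f b)) \sum_(r : 'I_n.+1 | (0 < r <= head 0 (f b))%N) F (f b) r).
  by rewrite pair_big_dep /=; apply: eq_bigl => l; rewrite inE /P andbA.
transitivity (\sum_(b | P (f b)) \sum_(1 <= r < (head 0%N (f b)).+1) F (f b) r).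
  apply: eq_bigr => b Pb; have hn : (head 0 (f b) < n.+1)%N.
    by rewrite /f; case: (val b) => //= x ? ; exact: ltn_ord.
  rewrite (big_nat_widen _ _ n.+1) // (big_nat_widenl _ 0) // big_mkord.
  by apply: eq_bigl => r; rewrite ltnS andbC.
rewrite -big_filter -(big_map f predT (fun a => \sum_(1 <= r < (head 0%N a).+1) F a r)).
apply: perm_big; apply: uniq_perm => [||a].
- rewrite map_inj_uniq; first by rewrite filter_uniq // index_enum_uniq.
  by move=> x y /(inj_map val_inj)/val_inj.
- exact: compositions_uniq.
apply/mapP/idP => [[b + ->]|ac]; first by rewrite mem_filter mem_compositions => /andP[].
have := ac; rewrite mem_compositions => /andP[a1 /eqP sa].
have an : (size (map (@inord n) a) <= n)%N by rewrite size_map (leq_trans (size_composition ac)).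
have fa : f (Bseq an) = a.
  rewrite /f /= -map_comp; apply: map_id_in => x xa /=.
  rewrite inordK // ltnS; apply: leq_trans cn; rewrite -sa.
  by rewrite (perm_sumn (perm_to_rem xa)) /= leq_addr.
by exists (Bseq an) => //; rewrite mem_filter mem_index_enum fa /P a1 sa eqxx.
Qed.

End CompositionSums.

(** * Entries as sums over edge sets *)

Section SubgraphTripleStatistics.
Variables (n : nat) (G : mgraph n) (S : {set ctriple G}).
Hypothesis ST_S : S \in ST G.

Lemma size_calpha_le c : c \in S -> (size (calpha c) <= #|cverts c|)%N.
Proof.
move=> /(ST_component ST_S)/and5P[_ _ a1 /eqP <- _].
by elim: (calpha c) a1 => //= x a IHa /andP[x1 /IHa]; lia.
Qed.

Lemma calpha_cons c : c \in S -> calpha c = head 0%N (calpha c) :: behead (calpha c).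
Proof.
move=> /(ST_component ST_S)/and5P[_ _ _ _]; case: (calpha c) => //= /andP[r0 r1].
by have := leq_trans r0 r1.
Qed.

Lemma sum_cverts : (\sum_(c in S) #|cverts c| = n)%N.
Proof.
under eq_bigr do rewrite -sum1_card.
rewrite (exchange_big_dep predT) //= -[RHS]card_ord -sum1_card.
apply: eq_bigr => v _; have [c cS vc] := ST_cover ST_S v.
rewrite (bigD1 c) /= ?cS // big1 // => d /andP[/andP[dS vd]] /eqP[].
exact: (ST_eq ST_S dS cS vd vc).
Qed.

Lemma size_st_type : size (st_type S) = (\sum_(c in S) size (calpha c))%N.
Proof.
by rewrite size_sort size_flatten sumnE /shape -map_comp big_map big_enum.
Qed.

Lemma exists_ST_at c v (q : pred (ctriple G)) : c \in S -> v \in cverts c ->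
  [exists d in S, (v \in cverts d) && q d] = q c.
Proof.
move=> cS vc; apply/existsP/idP => [[d /and3P[dS vd]]|qc]; last first.
  by exists c; rewrite cS vc.
by rewrite (ST_eq ST_S dS cS vd vc).
Qed.

Lemma alpha_atE c v : c \in S -> v \in cverts c -> alpha_at S v = calpha c.
Proof.
move=> cS vc; rewrite /alpha_at; case: pickP => [d /andP[dS vd]|/(_ c)].
  by rewrite (ST_eq ST_S dS cS vd vc).
by rewrite cS vc.
Qed.

(** Exactly one component contains v, so a condition at a marked vertex can be written as a product
    over all components, the form that [sum_ST] requires. *)
Lemma prod_at (R : comNzRingType) c v (X Y : ctriple G -> R) : c \in S -> v \in cverts c ->
  \prod_(d in S) (if v \in cverts d then X d else Y d) =
  X c * \prod_(d in S | d != c) Y d.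
Proof.
move=> cS vc; rewrite (bigD1 c) //= vc; congr (_ * _).
apply: eq_bigr => d /andP[dS /eqP dc]; case: ifP => // vd.
by case: dc; exact: (ST_eq ST_S dS cS vd vc).
Qed.

Lemma prod_st_rtype (R : comNzRingType) (e : nat -> R) c v : c \in S -> v \in cverts c ->
  \prod_(k <- st_rtype S v) e k =
  \prod_(k <- behead (calpha c)) e k *
  \prod_(d in S | d != c) \prod_(k <- calpha d) e k.
Proof.
move=> cS vc; rewrite /st_rtype (alpha_atE cS vc).
set L := [seq calpha d | d <- rem c (enum S)].
(* [rem] may delete a copy of alpha_1 coming from another component, but only the multiset of parts
   matters. *)
have /(perm_big (op := *%R)) -> :
    perm_eq (rem (head 0%N (calpha c)) (st_type S)) (behead (calpha c) ++ flatten L).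
  have tS : perm_eq (st_type S) (calpha c ++ flatten L).
    rewrite perm_sort; apply: (@perm_flatten _ _ (calpha c :: L)).
    by rewrite -map_cons perm_map // perm_to_rem // mem_enum.
  rewrite -(perm_cons (head 0%N (calpha c))) -cat_cons -calpha_cons //.
  apply: (perm_trans _ tS); rewrite perm_sym perm_to_rem //.
  by rewrite (perm_mem tS) mem_cat {2}(calpha_cons cS) mem_head.
rewrite big_cat big_flatten big_map rem_filter ?enum_uniq // big_filter big_enum_cond /=.
by [].
Qed.

End SubgraphTripleStatistics.

Section EdgeSubsetExpansion.
Variables (R : comNzRingType) (e : nat -> R) (t : R).
Variables (n : nat) (G : mgraph n.+1) (i j : nat).
Let GP := gadd G (gpath j).
Let glue : 'I_(n + j).+1 := gadd_lvertex j ord_max.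
Let path_in (C : {set 'I_(n + j).+1}) := [forall v : 'I_(n + j).+1, (n <= v)%N ==> (v \in C)].

(* Without the factors (-1)^(1-j) t^(1-j). *)
Definition generic_entry : R :=
  \sum_(S in STi G i j)
    (-1) ^+ ((n + j).+1 - size (st_type S)) * t ^+ st_edges S
    * \prod_(k <- st_rtype S ord0) e k.

(** Weight of the first part after summation over r, with b telling whether the component contains
    vertex 1. There the part is i + 1, r is 1 and the reduced type drops its e; elsewhere r takes k
    values. *)
Definition first_part (b : bool) (k : nat) : R :=
  if b then (k == i.+1)%:R else k%:R * e k.

Let first_weight (c : ctriple GP) : R :=
  if ord0 \in cverts c then
    ((head 0%N (calpha c) == i.+1) && (cr c == 1%N))%:R
      * \prod_(k <- behead (calpha c)) e k
  else \prod_(k <- calpha c) e k.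

Let last_weight (c : ctriple GP) : R :=
  if glue \in cverts c then (path_in (cverts c) && (j < last 0%N (calpha c))%N)%:R
  else 1.

Let weight (c : ctriple GP) : R :=
  (-1) ^+ (#|cverts c| - size (calpha c)) * t ^+ #|cedges c|
  * (first_weight c * last_weight c).

Let glued_weight (C : {set 'I_(n + j).+1}) : R :=
  if glue \in C then (path_in C)%:R * esum_last e j.+1 (first_part (ord0 \in C)) #|C|
  else esum_last e 0 (first_part (ord0 \in C)) #|C|.

(** Sign, edge count and reduced type are multiplicative over components. The two conditions of
    [STi] are separate factors, so they may concern the same component. *)
Lemma prod_weight S : S \in ST GP ->
  \prod_(c in S) weight c =
  if S \in STi G i j then
    (-1) ^+ ((n + j).+1 - size (st_type S)) * t ^+ st_edges S
    * \prod_(k <- st_rtype S ord0) e k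
  else 0.
Proof.
move=> ST_S; rewrite /weight !big_split /=.
have [c1 c1S v1] := ST_cover ST_S ord0; have [c2 c2S v2] := ST_cover ST_S glue.
rewrite [\prod_(c in S) first_weight c](prod_at ST_S _ _ c1S v1).
have -> : \prod_(c in S) last_weight c =
    (path_in (cverts c2) && (j < last 0%N (calpha c2))%N)%:R.
  by rewrite (prod_at ST_S _ _ c2S v2) big1 ?mulr1.
rewrite !prodrXr sumnB; last by move=> c cS; exact: (size_calpha_le ST_S cS).
rewrite (sum_cverts ST_S) -(size_st_type S).
have -> : (S \in STi G i j) = ((head 0%N (calpha c1) == i.+1) && (cr c1 == 1%N))
    && (path_in (cverts c2) && (j < last 0%N (calpha c2))%N).
  rewrite inE ST_S /=.
  by rewrite (exists_ST_at ST_S _ c1S v1) (exists_ST_at ST_S _ c2S v2).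
rewrite (prod_st_rtype ST_S e c1S v1).
case: (_ && (cr c1 == _)); last by rewrite !(mul0r, mulr0).
case: (path_in _ && _); last by rewrite !(mul0r, mulr0).
by rewrite !(mul1r, mulr1).
Qed.

Lemma sum_label_weight (C : {set 'I_(n + j).+1}) (D : {set edge GP}) : (0 < #|C|)%N ->
  \sum_(l in labels_of (n + j).+1 #|C|) weight (mk_ctriple C D l) =
  t ^+ #|D| * glued_weight C.
Proof.
(* [s] and [m] treat both cases at once: away from the glued vertex there is no path condition and
   the bound on the last part is void. *)
move=> C0; pose s : R := if glue \in C then (path_in C)%:R else 1.
pose m := if glue \in C then j.+1 else 0%N.
pose F (a : seq nat) r : R := (-1) ^+ (#|C| - size a) * t ^+ #|D|
  * ((if ord0 \in C then ((head 0%N a == i.+1) && (r == 1%N))%:R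
        * \prod_(k <- behead a) e k else \prod_(k <- a) e k)
     * (s * (m <= last 0%N a)%:R)).
transitivity (\sum_(l in labels_of (n + j).+1 #|C|) F [seq val k | k <- l.1] (val l.2)).
  apply: eq_bigr => l _; rewrite /weight /F; congr (_ * (_ * _)).
  rewrite /last_weight /s /m /=; case: ifP => _; last by rewrite mul1r.
  by rewrite -natrM mulnb.
rewrite sum_labels; last by rewrite -[X in (_ <= X)%N]card_ord max_card.
have -> : glued_weight C = s * esum_last e m (first_part (ord0 \in C)) #|C|.
  by rewrite /glued_weight /s /m; case: ifP => _; rewrite ?mul1r.
rewrite !mulr_sumr; apply: eq_big_seq => a; rewrite mem_compositions => /andP[a1 /eqP sa].
case: a a1 sa => [|x a] /=; first by move=> _ sa; rewrite -sa in C0.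
move=> /andP[x1 _] _; rewrite /F /first_part /=; case: ifP => _.
  rewrite big_ltn ?ltnS // eqxx andbT [X in _ + X]big_nat [X in _ + X]big1 ?addr0; last first.
    by move=> r /andP[r2 _]; rewrite (_ : (r == 1%N) = false) ?andbF ?mul0r ?mulr0 //; lia.
  by ring.
rewrite sumr_const_nat subSS subn0 big_cons -mulr_natl; ring.
Qed.

Lemma generic_entry_components : 
  generic_entry =
  \sum_(D : {set edge GP}) t ^+ #|D| * \prod_(C in components D) glued_weight C.
Proof.
have <- : \sum_(S in ST GP) \prod_(c in S) weight c = generic_entry.
  rewrite /generic_entry [RHS]big_mkcond [LHS]big_mkcond /=; apply: eq_bigr => S _.
  have [ST_S|nST] := boolP (S \in ST GP); first by rewrite prod_weight.
  by rewrite inE (negbTE nST).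
rewrite sum_ST; apply: eq_bigr => D _.
under eq_bigr => C CD do rewrite (sum_label_weight _ (card_components_gt0 CD)).
by rewrite big_split /= prodrXr sum_inner_edges.
Qed.

End EdgeSubsetExpansion.

Section EntryFormula.
Variables (R : comNzRingType) (e : nat -> R) (t : R).

Definition component_wt n i (C : {set 'I_n.+1}) : R :=
  esum_last e 0 (first_part e i (ord0 \in C)) #|C|.

Section Graph.
Variables (n : nat) (G : mgraph n.+1).

(** The path meets G only at the glued vertex, so its vertices can be connected only by its own
    edges, and all of them are needed. *)
Lemma path_in_glued j (D1 : {set edge G}) (D2 : {set edge (gpath j)}) :
  [forall v : 'I_(n + j).+1, (n <= v)%N ==>
      (v \in [set gadd_lvertex j x | x in component D1 ord_max] :|:
         [set gadd_rvertex n x | x in component D2 ord0])] = (D2 == setT).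
Proof.
apply/forallP/eqP => [pathD|-> v]; last first.
  apply/implyP=> nv; rewrite component_path inE; apply/orP; right.
  apply/imsetP; exists (inord (v - n)); rewrite ?inE //.
  by apply: val_inj; rewrite /= inordK; have := ltn_ord v; lia.
apply/setP=> k; rewrite [RHS]inE; apply/idPn => /notin_component_path/negP; apply.
have /implyP := pathD (gadd_rvertex n (lift ord0 k)); rewrite /= leq_addr inE.
case/(_ isT)/orP => [/imsetP[x _ /esym/gadd_vertex_eq[_ /(congr1 val)]] //|].
by rewrite mem_imset //; exact: gadd_rvertex_inj.
Qed.

(** Vertex 1 of the sum lies on the right side only when G has one vertex, and then it is the glued
    vertex, already in [A1]. *)
Lemma ord0_in_glued m (A1 : {set 'I_n.+1}) (A2 : {set 'I_m.+1}) :
  ord_max \in A1 ->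
  (ord0 \in [set gadd_lvertex m x | x in A1] :|: [set gadd_rvertex n x | x in A2])
    = (ord0 \in A1).
Proof.
move=> maxA.
have -> : ord0 = gadd_lvertex m ord0 :> 'I_(n + m).+1 by apply: val_inj.
rewrite inE mem_imset; last exact: gadd_lvertex_inj.
case: (boolP (ord0 \in A1)) => //= /negP nA; apply/imsetP => -[x _].
by case/gadd_vertex_eq => E; case: nA; rewrite E.
Qed.

Lemma component_wt_l m i (A : {set 'I_n.+1}) :
  component_wt i [set gadd_lvertex m x | x in A] = component_wt i A.
Proof.
rewrite /component_wt card_imset; last exact: gadd_lvertex_inj.
have -> : ord0 = gadd_lvertex m ord0 :> 'I_(n + m).+1 by apply: val_inj.
by rewrite mem_imset //; exact: gadd_lvertex_inj.
Qed.

(** Such a component avoids vertex 1 of the sum, so the row index does not affect its weight. *)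
Lemma component_wt_r m i i' (A : {set 'I_m.+1}) : ord0 \notin A ->
  component_wt i [set gadd_rvertex n x | x in A] = component_wt i' A.
Proof.
move=> A0; rewrite /component_wt card_imset; last exact: gadd_rvertex_inj.
have -> : (ord0 \in [set gadd_rvertex n x | x in A]) = false.
  apply/imsetP => -[x xA /(congr1 val) /= x0]; case/negP: A0.
  by rewrite (_ : ord0 = x) //; apply: val_inj => /=; lia.
by rewrite (negbTE A0) /first_part.
Qed.

(** The path condition forces all j path edges, whence t^j. The component of vertex n gains j
    vertices and carries the bound on the last part. *)
Lemma generic_entryE i j :
  generic_entry e t G i j =
  t ^+ j * \sum_(D : {set edge G}) t ^+ #|D|
    * \prod_(C in components D :\ component D ord_max) component_wt i C
    * esum_last e j.+1 (first_part e i (ord0 \in component D ord_max))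
        (#|component D ord_max| + j).
Proof.
rewrite generic_entry_components sum_edge_sets mulr_sumr; apply: eq_bigr => D1 _.
under [LHS]eq_bigr do rewrite card_edge_sum prod_components_edge_sum path_in_glued inE imset_f
  ?mem_component // orTb.
rewrite (bigD1 [set: edge (gpath j)]) // -[LHS]/(_ + _) [X in _ + X]big1 ?addr0; last first.
  by move=> D2 /negbTE ->; rewrite !mul0r mulr0.
(* The full path has a single component, which has been merged, so no other factor comes from its
   side. *)
rewrite [X in _ * (_ * (_ * X))]big_pred0 ?mulr1; last first.
  move=> C; rewrite !inE component_path; apply/andP => -[CT /imsetP[v _ CE]]; case/eqP: CT.
  by rewrite CE -(component_path j); apply: component_eq; rewrite component_path inE.
rewrite eqxx mul1r ord0_in_glued ?mem_component // card_glued component_path.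
rewrite !cardsT !card_ord exprD.
under [X in _ * _ * (_ * X) = _]eq_bigr => C CP.
  have /setD1P[/eqP CN CD] := CP.
  have -> : (gadd_lvertex j ord_max \in [set gadd_lvertex j x | x in C]) = false.
    rewrite mem_imset; last exact: gadd_lvertex_inj.
    by apply/negP => /(components_eq CD).
  rewrite -/(component_wt i [set gadd_lvertex j x | x in C]) component_wt_l.
  over.
ring.
Qed.

End Graph.
End EntryFormula.

(** * Merging compositions at a glued vertex *)

Section MoreCompositionSums.
Variables (R : comNzRingType) (e : nat -> R).

(** This is [esum_last_split] in the shape of a matrix product. The delta contributes (-1)^k times
    [hsum], which cancels the explicit sign, and vanishes for k > b, so the range m need not depend
    on the component. *)
Lemma esum_last_merge f m a b : (b <= m)%N ->
  \sum_(k < m.+1) (-1) ^+ k * esum_last e k.+1 f (a.+1 + k)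
    * esum_last e 0 (fun i => (i == k.+1)%:R) b.+1 =
  esum_last e 0 f (a.+1 + b).
Proof.
move=> bm; rewrite addSn esum_last_split.
rewrite (big_ord_widen m.+1 (fun k => esum_last e k.+1 f (a + k).+1 * hsum e (b - k))) //.
rewrite [RHS]big_mkcond /=; apply: eq_bigr => k _.
rewrite esum_last_delta ltnS addSn; case: leqP => kb; last by rewrite mulr0.
have -> : forall x y : R, (-1) ^+ k * x * ((-1) ^+ k * y) = (-1) ^+ k * (-1) ^+ k * (x * y).
  by move=> x y; ring.
by rewrite -expr2 sqrr_sign mul1r.
Qed.

Lemma esum_last_delta_small j k c : (0 < c < k)%N ->
  esum_last e j (fun i => (i == k)%:R) c = 0.
Proof.
case/andP=> c0 ck; rewrite (@eq_esum_last _ _ _ (fun=> 0)) //.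
  by rewrite /esum_last big1 // => a _; rewrite mul0r mulr0.
by move=> i /andP[_ ic]; rewrite (_ : (i == k) = false) //; lia.
Qed.

End MoreCompositionSums.

(** * Entries of M_G and the function XB over a commutative ring *)

Section Entries.
Variables (R : comNzRingType) (e : nat -> R) (t t' : R).
Hypothesis tK : t * t' = 1.

(** With [t'] as the inverse of t, no integer exponents occur; [t' ^+ j] cancels the weight of the
    path edges. *)
Definition entry n (G : mgraph n.+1) i j : R :=
  (-1) ^+ j * t' ^+ j * generic_entry e t G i j.

(** For elementary [e] this is the power sum p_c, and [xb] becomes the power sum expansion of the
    Tutte symmetric function. *)
Definition psum := esum_last e 0 (fun k => k%:R * e k).

(* The first entry of v M_G, by [entry_xb]. *)
Definition xb n (G : mgraph n) : R :=
  \sum_(D : {set edge G}) t ^+ #|D| * \prod_(C in components D) psum #|C|.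

Section Graph.
Variables (n : nat) (G : mgraph n.+1).
Implicit Type D : {set edge G}.

Lemma entryE i j :
  entry G i j =
  \sum_(D : {set edge G}) t ^+ #|D|
    * \prod_(C in components D :\ component D ord_max) component_wt e i C
    * ((-1) ^+ j * esum_last e j.+1 (first_part e i (ord0 \in component D ord_max))
        (#|component D ord_max| + j)).
Proof.
have ttj : t' ^+ j * t ^+ j = 1 by rewrite -exprMn mulrC tK expr1n.
rewrite /entry generic_entryE mulrA -[(-1) ^+ j * _ * _]mulrA ttj mulr1 mulr_sumr.
by apply: eq_bigr => D _; ring.
Qed.

Lemma card_component_gt0 D v : (0 < #|component D v|)%N.
Proof. exact: card_components_gt0 (component_in_components D v). Qed.

Lemma card_component_le D v : (#|component D v| <= n.+1)%N.
Proof. by rewrite -[X in (_ <= X)%N]card_ord max_card. Qed.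

(** For j = 0 nothing is attached and every last part is at least 1, so the component of vertex n is
    weighted like the others. *)
Lemma entry_col0 i :
  entry G i 0 =
  \sum_(D : {set edge G}) t ^+ #|D| * \prod_(C in components D) component_wt e i C.
Proof.
rewrite entryE; apply: eq_bigr => D _; rewrite mul1r addn0.
rewrite [in RHS](big_setD1 _ (component_in_components D ord_max)) /= -mulrA; congr (_ * _).
rewrite mulrC; congr (_ * _); rewrite /component_wt.
by rewrite -(prednK (card_component_gt0 D ord_max)) esum_last_gt0.
Qed.

Lemma component_wt_notin i (C : {set 'I_n.+1}) : ord0 \notin C -> component_wt e i C = psum #|C|.
Proof. by move=> /negbTE C0; rewrite /component_wt C0. Qed.

Lemma component_wt_in i (C : {set 'I_n.+1}) : ord0 \in C ->
  component_wt e i C = esum_last e 0 (fun k => (k == i.+1)%:R) #|C|.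
Proof. by move=> C0; rewrite /component_wt C0. Qed.

Lemma prod_component_wt i D :
  \prod_(C in components D) component_wt e i C =
  esum_last e 0 (fun k => (k == i.+1)%:R) #|component D ord0|
  * \prod_(C in components D :\ component D ord0) psum #|C|.
Proof.
rewrite (big_setD1 _ (component_in_components D ord0)) /= component_wt_in ?mem_component //.
congr (_ * _); apply: eq_bigr => C /setD1P[/eqP C0 CD]; rewrite component_wt_notin //.
by apply/negP => /(components_eq CD).
Qed.

(** The component of vertex 1 is too small for a first part i + 1, even if it contains the path.
    This gives finite columns and the triangularity of B. *)
Lemma entry_eq0 i j : (n + j < i)%N -> entry G i j = 0.
Proof.
move=> ni; rewrite entryE big1 // => D _.
have C0 := card_component_gt0 D; have Cn := card_component_le D.
have [max0|max0] := boolP (ord0 \in component D ord_max).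
  rewrite esum_last_delta_small ?mulr0 //.
  by have := C0 ord_max; have := Cn ord_max; lia.
rewrite (big_setD1 (component D ord0)) /=; last first.
  rewrite !inE component_in_components andbT; apply: contraNneq max0 => <-; exact: mem_component.
rewrite component_wt_in ?mem_component // esum_last_delta_small ?(mul0r, mulr0) //.
by have := C0 ord0; have := Cn ord0; lia.
Qed.

(** By linearity in the weight of the first part, the deltas at the component of vertex 1 add up to
    k e_k, the weight of every other component. *)
Lemma entry_xb : \sum_(k < n.+1) k.+1%:R * e k.+1 * entry G k 0 = xb G.
Proof.
under eq_bigr do rewrite entry_col0 mulr_sumr.
rewrite exchange_big; apply: eq_bigr => D _ /=.
under eq_bigr do rewrite prod_component_wt mulrCA [X in _ * X]mulrA.
rewrite -mulr_sumr; congr (_ * _); rewrite -mulr_suml.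
rewrite [RHS](big_setD1 _ (component_in_components D ord0)) /=; congr (_ * _).
rewrite -esum_last_linear; apply: eq_esum_last; last exact: card_component_gt0.
move=> k /andP[k0 kC].
have kn : (k.-1 < n.+1)%N by rewrite prednK // (leq_trans kC) // card_component_le.
rewrite (bigD1 (Ordinal kn)) //= prednK // eqxx mulr1 big1 ?addr0 // => i /eqP ik.
rewrite (_ : (k == i.+1) = false) ?mulr0 //; apply/eqP => ki; apply: ik; apply: val_inj.
by rewrite /= ki.
Qed.

(** A first part n + 1 fills all of G, so D must be connected and spanning and the composition has
    one part. *)
Lemma entry_diag :
  entry G n 0 = (-1) ^+ n * \sum_(D : {set edge G} | component D ord0 == setT) t ^+ #|D|.
Proof.
rewrite entry_col0 mulr_sumr [RHS]big_mkcond /=; apply: eq_bigr => D _.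
rewrite prod_component_wt; have [CT|CT] := eqVneq (component D ord0) setT; last first.
  rewrite esum_last_delta_small ?(mul0r, mulr0) // card_component_gt0 /=.
  by rewrite -[X in (_ < X)%N]card_ord -cardsT proper_card // properT.
rewrite CT big_pred0 ?mulr1; last first.
  move=> C; rewrite !inE; apply/andP => -[/eqP CN CD]; have [v vC] := components_inhabited CD.
  by apply: CN; rewrite (components_eq CD vC) -CT; apply: component_eq; rewrite CT inE.
by rewrite cardsT card_ord esum_last_delta leqnn subnn hsum0 mulr1 mulrC.
Qed.

End Graph.

(** Components away from the glued vertex give the same factors on both sides; for the merged one
    the identity is [esum_last_merge]. *)
Lemma entry_gadd n m (G : mgraph n.+1) (H : mgraph m.+1) i :
  entry (gadd G H) i 0 = \sum_(k < m.+1) entry G i k * entry H k 0.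
Proof.
rewrite entry_col0 sum_edge_sets.
under [RHS]eq_bigr do rewrite entryE entry_col0 mulr_suml.
rewrite [RHS]exchange_big; apply: eq_bigr => D1 _ /=.
under [RHS]eq_bigr do rewrite mulr_sumr.
rewrite [RHS]exchange_big; apply: eq_bigr => D2 _ /=.
under [RHS]eq_bigr do rewrite prod_component_wt.
rewrite card_edge_sum prod_components_edge_sum exprD.
under [X in _ * (_ * (X * _))]eq_bigr do rewrite component_wt_l.
rewrite [X in _ * (_ * (_ * X))](eq_bigr (fun C : {set 'I_m.+1} => psum #|C|)); last first.
  move=> C /setD1P[/eqP C0 CD].
  have nC : ord0 \notin C by apply/negP => /(components_eq CD).
  by rewrite (@component_wt_r R e n m i 0%N) ?component_wt_notin.
rewrite /component_wt ord0_in_glued ?mem_component // card_glued.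
set f := first_part e i _; set P1 := \prod_(C in _) _; set P2 := \prod_(C in _) _.
have [C1 C2] := (card_component_gt0 D1 ord_max, card_component_gt0 D2 ord0).
have C2m := card_component_le D2 ord0.
transitivity (\sum_(k < m.+1) t ^+ #|D1| * t ^+ #|D2| * P1 * P2 *
    ((-1) ^+ k * esum_last e k.+1 f (#|component D1 ord_max| + k)
      * esum_last e 0 (fun i => (i == k.+1)%:R) #|component D2 ord0|)); last first.
  by apply: eq_bigr => k _; ring.
rewrite -mulr_sumr -{2}(prednK C1) -{2}(prednK C2) esum_last_merge; last by lia.
rewrite (prednK C1); ring.
Qed.

Section Isomorphism.
Variables (n n' : nat) (G : mgraph n) (G' : mgraph n').
Variables (sigma : 'I_n -> 'I_n') (tau : edge G -> edge G').
Hypotheses (sigma_bij : bijective sigma) (tau_bij : bijective tau).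
Hypothesis ends_tau : forall a, ends (tau a) = sigma @: ends a.

Lemma component_iso (D : {set edge G}) v : component (tau @: D) (sigma v) = sigma @: component D v.
Proof.
have [sI tI] := (bij_inj sigma_bij, bij_inj tau_bij).
apply: component_eqP; first by rewrite imset_f // mem_component.
  move=> _ x y /imsetP[a aD ->]; rewrite ends_tau => /imsetP[x' xa ->] /imsetP[y' ya ->].
  by rewrite !mem_imset //; apply: component_saturated aD xa ya.
move=> _ /imsetP[u + ->]; rewrite inE => /connectP[p]; elim: p v => [|z p IHp] v /=.
  by move=> _ ->; exact: connect0.
case/andP=> /existsP[a /andP[aD /eqP avz]] /IHp zu /zu; apply: connect_trans.
by apply: (@connect_ends _ _ _ (tau a)); rewrite ?ends_tau ?mem_imset // avz !inE eqxx ?orbT.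
Qed.

Lemma components_iso (D : {set edge G}) :
  components (tau @: D) = [set sigma @: C | C : {set 'I_n} in components D].
Proof.
have [sigma' _ sK] := sigma_bij.
apply/setP=> C; apply/imsetP/imsetP => [[v _ ->]|[_ /imsetP[v _ ->] ->]].
  exists (component D (sigma' v)); first exact: component_in_components.
  by rewrite -component_iso sK.
by exists (sigma v); rewrite // component_iso.
Qed.

(** The numbers of vertices n and n' are separate variables, so that n + m and m + n can be matched
    without casts. *)
Lemma xb_iso : xb G = xb G'.
Proof.
have [sI tI] := (bij_inj sigma_bij, bij_inj tau_bij).
rewrite /xb [RHS](reindex (fun D : {set edge G} => tau @: D)) /=; last first.
  have [tau' tK1 tK2] := tau_bij; exists (fun D : {set edge G'} => tau' @: D) => D _ /=;
    by rewrite -imset_comp -[RHS]imset_id; apply: eq_imset => a /=; rewrite ?tK1 ?tK2.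
apply: eq_bigr => D _; rewrite card_imset // components_iso.
rewrite [X in _ = _ * X]big_imset /=; last exact: in2W (imset_inj sI).
by congr (_ * _); apply: eq_bigr => C _; rewrite card_imset.
Qed.

End Isomorphism.

End Entries.

(** * Infinite matrices *)

Section InfiniteMatrices.
Import boolp classical_sets functions cardinality fsbigop.
Variable R : comNzRingType.
Implicit Types A B C : imatrix R.

Lemma imulE N A B i j : (forall k, (N <= k)%N -> A i k * B k j = 0) ->
  imul A B i j = \sum_(k < N) A i k * B k j.
Proof.
move=> AB0; rewrite (fsbig_ord _ _ (fun k => A i k * B k j)) /imul.
apply/esym/fsbig_widen => // k [_ /=] /negP; rewrite -leqNgt; exact: AB0.
Qed.

Lemma imatrixP A B : (forall i j, A i j = B i j) -> A = B.
Proof. by move=> AB; apply: funext => i; apply: funext => j. Qed.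

Definition colfin A := forall j, exists N, forall k, (N <= k)%N -> A k j = 0.
Definition rowfin A := colfin (itr A).

Lemma itrK A : itr (itr A) = A. Proof. by []. Qed.

Lemma itr_imul A B : itr (imul A B) = imul (itr B) (itr A).
Proof. by apply: imatrixP => i j; apply: eq_fsbigr => k _; rewrite mulrC. Qed.

Lemma colfin_upto A N : colfin A ->
  exists M, forall k i, (k < N)%N -> (M <= i)%N -> A i k = 0.
Proof.
move=> cA; elim: N => [|N [M IHM]]; first by exists 0%N.
have [M' AM'] := cA N; exists (maxn M M') => k i; rewrite ltnS leq_eqVlt geq_max.
by case/orP=> [/eqP ->|kN] /andP[Mi M'i]; [exact: AM'|exact: IHM].
Qed.

Lemma colfin_imul A B : colfin A -> colfin B -> colfin (imul A B).
Proof.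
move=> cA cB j; have [N BN] := cB j; have [M AM] := colfin_upto N cA.
exists M => i Mi; rewrite (@imulE N) => [|k /BN ->]; last by rewrite mulr0.
by rewrite big1 // => k _; rewrite AM ?mul0r.
Qed.

(** One factor is always arbitrary: the middle one here, the left one in [imulA_cc], the right one
    in [imulA_rr]. *)
Lemma imulA_rc A B C : rowfin A -> colfin C -> imul (imul A B) C = imul A (imul B C).
Proof.
move=> rA cC; apply: imatrixP => i j; have [N AN] := rA i; have [M CM] := cC j.
rewrite (@imulE M) => [|k /CM ->]; last by rewrite mulr0.
rewrite (@imulE N) => [|k /AN]; last by rewrite /itr => ->; rewrite mul0r.
under [LHS]eq_bigr => k _.
  rewrite (@imulE N) => [|l /AN]; last by rewrite /itr => ->; rewrite mul0r.
  rewrite mulr_suml; over.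
rewrite exchange_big; apply: eq_bigr => l _ /=.
rewrite (@imulE M) => [|k /CM ->]; last by rewrite mulr0.
by rewrite mulr_sumr; apply: eq_bigr => k _; rewrite mulrA.
Qed.

Lemma imulA_cc A B C : colfin B -> colfin C -> imul (imul A B) C = imul A (imul B C).
Proof.
move=> cB cC; apply: imatrixP => i j; have [M CM] := cC j.
have [N BN] := colfin_upto M cB.
rewrite (@imulE M) => [|k /CM ->]; last by rewrite mulr0.
rewrite (@imulE N) => [|k Nk]; last first.
  rewrite (@imulE M) => [|l /CM ->]; last by rewrite mulr0.
  by rewrite big1 ?mulr0 // => l _; rewrite BN ?mul0r.
under [LHS]eq_bigr => k _.
  rewrite (@imulE N) => [|l Nl]; last by rewrite BN ?mulr0.
  rewrite mulr_suml; over.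
rewrite exchange_big; apply: eq_bigr => l _ /=.
rewrite (@imulE M) => [|k /CM ->]; last by rewrite mulr0.
by rewrite mulr_sumr; apply: eq_bigr => k _; rewrite mulrA.
Qed.

Lemma imulA_rr A B C : rowfin A -> rowfin B -> imul (imul A B) C = imul A (imul B C).
Proof.
move=> rA rB; rewrite -[LHS]itrK -[RHS]itrK; congr itr.
by rewrite !itr_imul imulA_cc.
Qed.

Lemma imul1l A : imul (i1 R) A = A.
Proof.
apply: imatrixP => i j; rewrite (@imulE i.+1) => [|k ik]; last first.
  by rewrite /i1 (ltn_eqF ik) mul0r.
rewrite big_ord_recr /= /i1 eqxx mul1r big1 ?add0r // => k _.
by rewrite (gtn_eqF (ltn_ord k)) mul0r.
Qed.

Lemma itr_i1 : itr (i1 R) = i1 R.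
Proof. by apply: imatrixP => i j; rewrite /itr /i1 eq_sym. Qed.

Lemma imul1r A : imul A (i1 R) = A.
Proof. by rewrite -[LHS]itrK itr_imul itr_i1 imul1l. Qed.

Lemma iupper_colfin A : iupper A -> colfin A.
Proof. by move=> uA j; exists j.+1 => k; apply: uA. Qed.

(** Back substitution: the last unknown is [d N * y N], and subtracting its column leaves a
    right-hand side supported below N. *)
Lemma upper_solve B (d : nat -> R) : iupper B -> (forall i, B i i * d i = 1) ->
  forall N (y : nat -> R), (forall i, (N <= i)%N -> y i = 0) ->
  exists2 x : nat -> R, (forall i, (N <= i)%N -> x i = 0) &
    forall i, \sum_(k < N) B i k * x k = y i.
Proof.
move=> uB Bd; elim=> [|N IHN] y y0.
  by exists (fun=> 0) => // i; rewrite big_ord0 y0.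
have [|x x0 xE] := IHN (fun i => y i - B i N * (d N * y N)).
  move=> i; rewrite leq_eqVlt => /predU1P[<-|Ni]; first by rewrite mulrA Bd mul1r subrr.
  by rewrite y0 // uB // mul0r subr0.
exists (fun k => if k == N then d N * y N else x k) => [i Ni|i].
  by rewrite (gtn_eqF Ni) x0 // ltnW.
rewrite big_ord_recr /= eqxx (eq_bigr (fun k : 'I_N => B i k * x k)) ?xE ?subrK // => k _.
by rewrite (ltn_eqF (ltn_ord k)).
Qed.

Lemma upper_rinv B (d : nat -> R) : iupper B -> (forall i, B i i * d i = 1) ->
  exists2 C, iupper C & imul B C = i1 R.
Proof.
move=> uB Bd.
have /choice[X XP] j : exists x : nat -> R, (forall i, (j < i)%N -> x i = 0) /\
    forall i, \sum_(k < j.+1) B i k * x k = i1 R i j.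
  have [|x x0 xE] := upper_solve uB Bd (N := j.+1) (y := fun i => i1 R i j).
    by move=> i ji; rewrite /i1 (gtn_eqF ji).
  by exists x.
exists (fun i j => X j i) => [i j|]; first by have [+ _] := XP j; apply.
apply: imatrixP => i j; have [X0 XE] := XP j.
by rewrite (@imulE j.+1) => [|k /X0 ->]; rewrite ?mulr0 ?XE.
Qed.

Lemma upper_mul_diag B C i : iupper B -> iupper C -> imul B C i i = B i i * C i i.
Proof.
move=> uB uC; rewrite (@imulE i.+1) => [|k ik]; last by rewrite uC ?mulr0.
by rewrite big_ord_recr /= big1 ?add0r // => k _; rewrite uB ?mul0r.
Qed.

(** A triangular right inverse C has an invertible diagonal, hence a right inverse X of its own;
    then C B = C (B (C X)) = C X = 1. *)
Lemma iinvP B (d : nat -> R) : iupper B -> (forall i, B i i * d i = 1) ->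
  [/\ iupper (Defs.iinv B), imul B (Defs.iinv B) = i1 R & imul (Defs.iinv B) B = i1 R].
Proof.
move=> uB Bd; have [C uC BC] := upper_rinv uB Bd.
have [|X uX CX] := @upper_rinv C (fun i => B i i) uC.
  by move=> i; rewrite mulrC -upper_mul_diag // BC /i1 eqxx.
have cC := iupper_colfin uC; have cX := iupper_colfin uX.
have CB : imul C B = i1 R by rewrite -[B]imul1r -CX -(imulA_cc B) // BC imul1l CX.
exact: (@xgetI _ _ [set X : imatrix R | [/\ iupper X, imul B X = i1 R
  & imul X B = i1 R]]%classic C).
Qed.

Lemma rowfin_itr A : colfin A -> rowfin (itr A).
Proof. by []. Qed.

(** Multiply A B' = B^T A'^T by C^T on the left and by C' on the right. *)
Lemma imul_itr_rinv A A' B B' C C' :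
  colfin B -> colfin C -> colfin B' -> colfin C' ->
  imul B C = i1 R -> imul B' C' = i1 R -> imul A B' = itr (imul A' B) ->
  imul (itr A') C' = imul (itr C) A.
Proof.
move=> cB cC cB' cC' BC B'C' AB'.
rewrite -[A]imul1r -B'C' -(imulA_cc _ cB' cC') AB' itr_imul.
rewrite -(imulA_rc _ (rowfin_itr cC) cC').
by rewrite -(imulA_rr _ (rowfin_itr cC) (rowfin_itr cB)) -itr_imul BC itr_i1 imul1l.
Qed.

(** Multiply A M' B = B^T M^T A^T by C^T on the left and by C on the right. *)
Lemma imul_itr_intertwine A B C M M' :
  colfin B -> colfin C -> colfin M -> colfin M' -> imul B C = i1 R ->
  imul A (imul M' B) = itr (imul A (imul M B)) ->
  imul (imul (itr C) A) M' = imul (itr M) (imul (itr A) C).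
Proof.
move=> cB cC cM cM' BC AMB; have [rB rC] := (rowfin_itr cB, rowfin_itr cC).
rewrite (imulA_rc _ rC cM') -[M']imul1r -BC -(imulA_cc _ cB cC).
rewrite -(imulA_cc _ (colfin_imul cM' cB) cC) AMB !itr_imul.
rewrite (imulA_rr _ rB (rowfin_itr cM)) (imulA_rc _ rB cC) (imulA_rc _ (rowfin_itr cM) cC).
by rewrite -(imulA_rr _ rC rB) -[imul (itr C) _]itr_imul BC itr_i1 imul1l.
Qed.

End InfiniteMatrices.

(** * Reversal *)

Section Reversal.
Variables (R : comNzRingType) (e : nat -> R) (t : R).

Lemma inord_sub_bij N N' : N = N' ->
  bijective (fun v : 'I_N.+1 => inord (N - v)%N : 'I_N'.+1).
Proof.
move=> <-; exists (fun v : 'I_N.+1 => inord (N - v)%N : 'I_N.+1) => v;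
  by apply: val_inj; rewrite /= !inordK; have := ltn_ord v; lia.
Qed.

Lemma xb_gadd_rev n m (X : mgraph n.+1) (Y : mgraph m.+1) :
  xb e t (gadd X (grev Y)) = xb e t (gadd Y (grev X)).
Proof.
pose tau (a : edge X + edge Y) : edge Y + edge X :=
  match a with inl a => inr a | inr a => inl a end.
pose tau' (a : edge Y + edge X) : edge X + edge Y :=
  match a with inl a => inr a | inr a => inl a end.
apply: (@xb_iso _ e t _ _ (gadd X (grev Y)) (gadd Y (grev X)) _ tau (inord_sub_bij (addnC n m))).
  by exists tau' => -[].
case=> a /=; rewrite /grev_ends -!imset_comp; apply: eq_imset => v;
  by apply: val_inj; rewrite /= inordK; have := ltn_ord v; lia.
Qed.

Lemma xb_gadd3_rev n k m (X : mgraph n.+1) (G : mgraph k.+1) (Y : mgraph m.+1) :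
  xb e t (gadd X (gadd G (grev Y))) = xb e t (gadd Y (gadd (grev G) (grev X))).
Proof.
pose tau (a : edge X + (edge G + edge Y)) : edge Y + (edge G + edge X) :=
  match a with inl a => inr (inr a) | inr (inl a) => inr (inl a) | inr (inr a) => inl a end.
pose tau' (a : edge Y + (edge G + edge X)) : edge X + (edge G + edge Y) :=
  match a with inl a => inr (inr a) | inr (inl a) => inr (inl a) | inr (inr a) => inl a end.
have nkm : (n + (k + m) = m + (k + n))%N by lia.
apply: (@xb_iso _ e t _ _ (gadd X (gadd G (grev Y))) (gadd Y (gadd (grev G) (grev X)))
  _ tau (inord_sub_bij nkm)).
  by exists tau' => -[|[]].
case=> [a|[a|a]] /=; rewrite /grev_ends -!imset_comp; apply: eq_imset => v;
  by apply: val_inj; rewrite /= inordK; have := ltn_ord v; lia.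
Qed.

Lemma component_grev n (G : mgraph n.+1) : connected_graph G ->
  component [set: edge (grev G)] ord0 = setT.
Proof.
case/andP=> _ /forall_inP conG.
have rev_bij : bijective (@rev_ord n.+1) by exists (@rev_ord n.+1); exact: rev_ordK.
have id_bij : bijective (@id (edge G)) by exists id.
(* Reversal is an isomorphism that fixes the edges and sends the last vertex to the first. *)
have := @component_iso _ _ G (grev G) _ id rev_bij id_bij (fun=> erefl) setT ord_max.
rewrite imset_id (_ : rev_ord ord_max = ord0); last by apply: val_inj; rewrite /= subnn.
rewrite (_ : component setT ord_max = setT); last first.
  apply/setP=> v; rewrite !inE.
  by have /forall_inP/(_ v) := conG ord_max (in_setT _); apply.
move=> ->; apply/setP=> v; rewrite [RHS]inE; apply/imsetP; exists (rev_ord v) => //.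
by rewrite rev_ordK.
Qed.

End Reversal.

(** * Specialization to symmetric functions over Q(t) *)

Lemma tvar_neq0 : tvar != 0.
Proof. by rewrite tofrac_eq0 polyX_eq0. Qed.

(** The sum comes from a polynomial whose value at 1 is the number of indices, nonzero in
    characteristic 0. *)
Lemma sum_tvar_neq0 (I : finType) (P : pred I) (f : I -> nat) i0 : P i0 ->
  \sum_(i | P i) tvar ^+ f i != 0.
Proof.
move=> Pi0; have -> : \sum_(i | P i) tvar ^+ f i = tofrac (\sum_(i | P i) 'X^(f i)).
  by rewrite rmorph_sum; apply: eq_bigr => i _; rewrite rmorphXn.
rewrite tofrac_eq0; apply/eqP => /(congr1 (fun p => p.[1])).
rewrite horner_sum horner0; under eq_bigr do rewrite hornerXn expr1n.
rewrite sumr_const => /eqP; rewrite Num.Theory.pnatr_eq0 => /eqP/card0_eq/(_ i0).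
by rewrite [LHS]Pi0.
Qed.

Notation eL := (Defs.esym Qt).
Notation tL := (tvar%:A : Lambda).
Notation tL' := (tvar^-1%:A : Lambda).

Lemma tLK : tL * tL' = 1.
Proof. by rewrite mulr_algl scalerA divff ?scale1r // tvar_neq0. Qed.

Lemma entry_scalar (K : fieldType) (A : comAlgType K) (x : K) (s E j : nat) : x != 0 ->
  ((-1) ^+ s * (-1) ^ (1 - j.+1%:Z) * x ^ (E%:Z + 1 - j.+1%:Z))%:A =
  (-1) ^+ j * x^-1%:A ^+ j * ((-1) ^+ s * x%:A ^+ E) :> A.
Proof.
move=> x0; have -> : 1 - j.+1%:Z = - j%:Z by lia.
have -> : E%:Z + 1 - j.+1%:Z = E%:Z - j%:Z by lia.
rewrite (expfzDr _ _ x0) -!exprnN -exprnP -!exprVn invrN1 -!in_algE.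
rewrite !rmorphM !rmorphXn !rmorphN1 /=; ring.
Qed.

Lemma tutte_mxE n (G : mgraph n.+1) i j :
  tutte_mx G i j = entry eL tL tL' G i j.
Proof.
rewrite /entry /generic_entry mulr_sumr; apply: eq_bigr => S _.
rewrite mulrA -[LHS]mulr_algl; congr (_ * _).
exact: entry_scalar tvar_neq0.
Qed.

Lemma tutte_mx_eq0 n (G : mgraph n.+1) i j : (n + j < i)%N -> tutte_mx G i j = 0.
Proof. by move=> ni; rewrite tutte_mxE (entry_eq0 _ tLK). Qed.

Lemma tutte_mx_colfin n (G : mgraph n.+1) : colfin (tutte_mx G).
Proof. by move=> j; exists (n + j).+1 => k; apply: tutte_mx_eq0. Qed.

Section FirstColumns.
Variables (m : nat -> nat) (W : forall j, mgraph (m j).+1).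

(** For m the identity this is [B_mx]. Other vertex numbers are needed because multiplication by M_G
    replaces W j by G + W j. *)
Definition col0_mx : imatrix Lambda := fun i j => tutte_mx (W j) i 0%N.

Lemma col0_mx_eq0 i j : (m j < i)%N -> col0_mx i j = 0.
Proof. by move=> mi; apply: tutte_mx_eq0; rewrite addn0. Qed.

Lemma col0_mx_colfin : colfin col0_mx.
Proof. by move=> j; exists (m j).+1 => k; apply: col0_mx_eq0. Qed.

End FirstColumns.

Lemma imul_tutte_col0 n (G : mgraph n.+1) (m : nat -> nat) (W : forall j, mgraph (m j).+1) :
  imul (tutte_mx G) (col0_mx W) = col0_mx (fun j => gadd G (W j)).
Proof.
apply: imatrixP => i j; rewrite (@imulE _ (m j).+1) => [|k mk]; last first.
  by rewrite col0_mx_eq0 ?mulr0.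
rewrite [RHS]tutte_mxE (entry_gadd _ tLK); apply: eq_bigr => k _.
by rewrite /col0_mx !tutte_mxE.
Qed.

Lemma imul_A_col0 (H : graph_family) (m : nat -> nat) (W : forall j, mgraph (m j).+1) i j :
  imul (A_mx H) (col0_mx W) i j = xb eL tL (gadd (H i) (W j)).
Proof.
(* The vector v is read as a matrix with all rows equal to v, so that [imulA_cc], which leaves the
   left factor arbitrary, applies. *)
rewrite -[LHS]/(imul (imul (fun=> vvec) (tutte_mx (H i))) (col0_mx W) i j).
rewrite imulA_cc; [|exact: tutte_mx_colfin|exact: col0_mx_colfin].
rewrite imul_tutte_col0 (@imulE _ (i + m j).+1) => [|k mk]; last by rewrite col0_mx_eq0 ?mulr0.
rewrite -(entry_xb _ tLK); apply: eq_bigr => k _.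
by rewrite /col0_mx tutte_mxE.
Qed.

Lemma imul_A_B_rev (H H' : graph_family) :
  imul (A_mx H) (B_mx (family_rev H')) = itr (imul (A_mx H') (B_mx (family_rev H))).
Proof.
apply: imatrixP => i j.
rewrite [LHS](imul_A_col0 H (family_rev H')) /itr.
rewrite [RHS](imul_A_col0 H' (family_rev H)); exact: xb_gadd_rev.
Qed.

Lemma imul_A_tutte_B_rev (H : graph_family) n (G : mgraph n.+1) :
  imul (A_mx H) (imul (tutte_mx (grev G)) (B_mx (family_rev H))) =
  itr (imul (A_mx H) (imul (tutte_mx G) (B_mx (family_rev H)))).
Proof.
have AGB k (G' : mgraph k.+1) i j :
    imul (A_mx H) (imul (tutte_mx G') (B_mx (family_rev H))) i j =
    xb eL tL (gadd (H i) (gadd G' (grev (H j)))).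
  rewrite [imul (tutte_mx G') _](imul_tutte_col0 G' (m := id) (family_rev H)).
  exact: (imul_A_col0 H (fun j => gadd G' (family_rev H j))).
apply: imatrixP => i j; apply: etrans (AGB _ (grev G) i j) _.
apply: etrans (esym (AGB _ G j i)); exact/esym/xb_gadd3_rev.
Qed.

Lemma B_mx_upper (H : graph_family) : iupper (B_mx H).
Proof. by move=> i j ji; apply: tutte_mx_eq0; rewrite addn0. Qed.

Lemma B_mx_inv (H : graph_family) : spanning_family H ->
  let B := B_mx (family_rev H) in
  [/\ iupper (Defs.iinv B), imul B (Defs.iinv B) = i1 _ & imul (Defs.iinv B) B = i1 _].
Proof.
move=> spanH.
pose c i := \sum_(D : {set edge (grev (H i))} | component D ord0 == setT) tvar ^+ #|D|.
apply: (@iinvP _ _ (fun i => (-1) ^+ i * ((c i)^-1)%:A)); first exact: B_mx_upper.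
move=> i; rewrite /B_mx tutte_mxE (entry_diag _ tLK).
have -> : \sum_(D : {set edge (grev (H i))} | component D ord0 == setT) tL ^+ #|D| = (c i)%:A.
  by rewrite /c scaler_suml; apply: eq_bigr => D _; rewrite -!in_algE rmorphXn.
rewrite mulrACA -expr2 sqrr_sign mul1r mulr_algl scalerA divff ?scale1r //.
(* The full edge set occurs in the sum because the members of a spanning family are connected. *)
by apply: (@sum_tvar_neq0 _ _ _ setT); rewrite component_grev.
Qed.

(** The right-hand side does not involve H', which gives the independence of K; for H' = H it is the
    second form of K. *)
Lemma K_mx_itr (H H' : graph_family) : spanning_family H -> spanning_family H' ->
  K_mx H' = imul (itr (Defs.iinv (B_mx (family_rev H)))) (A_mx H).
Proof.
move=> /B_mx_inv[uC BC _] /B_mx_inv[uC' BC' _].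
apply: (imul_itr_rinv _ _ _ _ BC BC' (imul_A_B_rev H H')); apply: iupper_colfin => //;
  exact: B_mx_upper.
Qed.

Lemma K_mx_tutte (H : graph_family) n (G : mgraph n.+1) : spanning_family H ->
  imul (K_mx H) (tutte_mx (grev G)) = imul (itr (tutte_mx G)) (K_mx H).
Proof.
move=> spanH; have [uC BC _] := B_mx_inv spanH.
(* Only the K on the left is rewritten; the one on the right keeps its definition, as
   [imul_itr_intertwine] expects. *)
rewrite {1}(K_mx_itr spanH spanH).
apply: (imul_itr_intertwine _ _ _ _ BC (imul_A_tutte_B_rev H G)).
- exact/iupper_colfin/B_mx_upper.
- exact: iupper_colfin.
- exact: tutte_mx_colfin.
- exact: tutte_mx_colfin.
Qed.

Theorem theorem5p12 :
  forall H : graph_family, spanning_family H ->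
    (forall H' : graph_family, spanning_family H' -> K_mx H' = K_mx H) /\
    (forall (n : nat) (G : mgraph n.+1),
       imul (K_mx H) (tutte_mx (grev G)) = imul (itr (tutte_mx G)) (K_mx H)).
Proof.
move=> H spanH; split=> [H' spanH'|n G]; [|exact: K_mx_tutte].
by rewrite (K_mx_itr spanH spanH') (K_mx_itr spanH spanH).
Qed.
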